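(* There is a universal constant $c>0$ such that for all integers $d,\tau\ge1$ and reals $\mu,\sigma_1>0$ the following holds for all sufficiently large $N$. For any (possibly randomized) algorithm with one-point feedback making $N$ oracle calls and returning $\hat x_N\in\mathbb{R}^d$, there exists a one-point instance with parameters $(d,\tau,\mu,\sigma_1)$ such that $$\mathbb{E}\|\hat x_N-x^*\|^2\ge c\,\frac{\sqrt{d(d+\tau)\sigma_1^2}}{\mu\sqrt N}.$$ Consequently, to get to the $\varepsilon$-neighborhood of the solution (that is, $\mathbb{E}\|\hat x_N-x^*\|^2\le\varepsilon$) with one-point feedback the algorithm needs at least $N=\Omega\left(\frac{d(d+\tau)\sigma_1^2}{\mu^2\varepsilon^2}\right)$ one-point oracle calls (as $\varepsilon\to0$, with a universal constant in $\Omega$).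
   Context: Norms are Euclidean. A one-point instance with parameters $(d,\tau,\mu,\sigma_1)$ consists of a complete separable metric space $\mathsf{Z}$ with its Borel $\sigma$-algebra, a stationary Markov chain $\{Z_i\}$ on it with kernel $\mathrm{Q}$ and unique invariant distribution $\pi$ satisfying $\sup_{z,z'}\frac12\|\mathrm{Q}^k(z,\cdot)-\mathrm{Q}^k(z',\cdot)\|_{\mathsf{TV}}\le(1/4)^{\lfloor k/\tau\rfloor}$ for all $k\in\mathbb{N}$, and a function $F:\mathbb{R}^d\times\mathsf{Z}\to\mathbb{R}$ such that $f(x)=\mathbb{E}_{Z\sim\pi}[F(x,Z)]$ is differentiable with $L$-Lipschitz gradient for some $L>0$, is $\mu$-strongly convex ($\frac\mu2\|x-y\|^2\le f(x)-f(y)-\langle\nabla f(y),x-y\rangle$ for all $x,y$), and $\mathbb{E}_\pi|F(x,Z)-f(x)|^2\le\sigma_1^2$ for all $x\in\mathbb{R}^d$. $x^*$ is the minimizer of $f$. One-point feedback: the $k$-th oracle call, at a point $x_k$ chosen by the algorithm from its previous observations and internal randomness, returns $F(x_k,Z_k)$. *)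

(* Defs.v *)
From HB Require Import structures.
From mathcomp Require Import all_boot all_order all_algebra.
From mathcomp Require Import all_classical all_reals all_analysis.

Set Implicit Arguments.
Unset Strict Implicit.
Unset Printing Implicit Defensive.

Import Order.TTheory GRing.Theory Num.Theory.
Import numFieldNormedType.Exports.

Local Open Scope classical_set_scope.
Local Open Scope ring_scope.

#[short(type="completeMetricType")]
HB.structure Definition CompleteMetric (R : numDomainType) :=
  { T of Metric R T & Complete T }.

Definition separable (T : topologicalType) : Prop :=
  exists2 S : set T, countable S & dense S.

Notation borel T := (g_sigma_algebraType (@open T)).

(* The library norm on row vectors is the sup norm. *)
Definition dotv (R : realType) (d : nat) (u v : 'rV[R]_d) : R :=
  \sum_(i < d) u ord0 i * v ord0 i.

Definition enorm (R : realType) (d : nat) (u : 'rV[R]_d) : R :=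
  Num.sqrt (dotv u u).

Definition gradient (R : realType) (d : nat) (f : 'rV[R]_d -> R^o)
    (x : 'rV[R]_d) : 'rV[R]_d :=
  \row_(i < d) ('d f x (delta_mx ord0 i) : R).

Definition lipschitz_gradient (R : realType) (d : nat) (L : R)
    (f : 'rV[R]_d -> R^o) : Prop :=
  forall x y, enorm (gradient f x - gradient f y) <= L * enorm (x - y).

Definition strongly_convex (R : realType) (d : nat) (mu : R)
    (f : 'rV[R]_d -> R^o) : Prop :=
  forall x y,
    mu / 2 * enorm (x - y) ^+ 2 <= f x - f y - dotv (gradient f y) (x - y).

Definition minimizer (R : realType) (d : nat) (f : 'rV[R]_d -> R) : 'rV[R]_d :=
  get [set x | forall y, f x <= f y].

Section kernel_iterates.
Context (dZ : measure_display) (Z : measurableType dZ) (R : realType).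

Definition pkcomp (k1 k2 : R.-pker Z ~> Z) : Z -> {measure set Z -> \bar R} :=
  mkcomp_noparam k1 k2.

Section pkcomp_instance.
Variables k1 k2 : R.-pker Z ~> Z.
HB.instance Definition _ := Kernel.on (pkcomp k1 k2).

Let pkcomp_prob z : pkcomp k1 k2 z [set: Z] = 1%E.
Proof.
rewrite /pkcomp /mkcomp_noparam /= /kcomp_noparam.
under eq_integral do rewrite prob_kernel.
by rewrite integral_cst// mul1e prob_kernel.
Qed.

HB.instance Definition _ := Kernel_isProbability.Build _ _ _ _ _
  (pkcomp k1 k2) pkcomp_prob.
End pkcomp_instance.

Fixpoint kpow (Q : R.-pker Z ~> Z) (k : nat) : R.-pker Z ~> Z :=
  if k is k'.+1 then pkcomp (kpow Q k') Q else kdirac (@measurable_id _ Z setT).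

(* k z with its probability structure, which the library does not infer. *)
Definition kernel_at (k : R.-pker Z ~> Z) (z : Z) : set Z -> \bar R := k z.

Section kernel_at_instance.
Variables (k : R.-pker Z ~> Z) (z : Z).
HB.instance Definition _ := Measure.copy (kernel_at k z) (k z).
HB.instance Definition _ := Measure_isProbability.Build _ _ _
  (kernel_at k z) (prob_kernel z).
End kernel_at_instance.
End kernel_iterates.

(* The difference is taken in the library type of finite signed measures; by
   Hahn_decomposition_uniq the value does not depend on the chosen
   decomposition, and two mutually singular probabilities are at distance 2. *)
Definition tv_norm (dZ : measure_display) (Z : measurableType dZ)
    (R : realType) (nu : {charge set Z -> \bar R}) : \bar R :=
  let hahn := cid (Hahn_decomposition nu) in
  charge_variation (projT2 (cid (projT2 hahn))) [set: Z].

Definition tv_dist (dZ : measure_display) (Z : measurableType dZ)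
    (R : realType) (m1 m2 : {finite_measure set Z -> \bar R}) : \bar R :=
  tv_norm (cadd (charge_of_finite_measure m1)
                (copp (charge_of_finite_measure m2))).

Definition invariant (dZ : measure_display) (Z : measurableType dZ)
    (R : realType) (Q : R.-pker Z ~> Z) (pi : probability Z R) : Prop :=
  forall A, measurable A -> (\int[pi]_z Q z A = pi A)%E.

(* The second clause says that Q (X n) B is a version of the conditional
   probability of [X n.+1 in B] given the sigma-algebra of X 0, ..., X n;
   stationarity follows when pi is invariant. *)
Definition markov_chain (dZ : measure_display) (Z : measurableType dZ)
    (R : realType) (Q : R.-pker Z ~> Z) (pi : probability Z R)
    (dW : measure_display) (W : measurableType dW) (P : probability W R)
    (X : nat -> {mfun W >-> Z}) : Prop :=
  (forall A, measurable A -> distribution P (X 0%N) A = pi A) /\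
  (forall n A B,
    g_sigma_preimage (fun (i : 'I_n.+1) => X i : W -> Z) A -> measurable B ->
    (P (A `&` X n.+1 @^-1` B) = \int[P]_(w in A) Q (X n w) B)%E).

(* F is required to be jointly measurable, so that the observations are random
   variables and the mean squared error below is meaningful. *)
Record one_point_instance (R : realType) (d tau : nat) (mu sigma1 : R) := {
  state : completeMetricType R;
  state_separable : separable state;
  trans : R.-pker (borel state) ~> (borel state);
  invd : probability (borel state) R;
  invd_invariant : invariant trans invd;
  invd_unique : forall nu : probability (borel state) R,
    invariant trans nu -> forall A, measurable A -> nu A = invd A;
  mixing : forall k : nat,
    (ereal_sup [set (2^-1)%:E *
        tv_dist (kernel_at (kpow trans k) z.1) (kernel_at (kpow trans k) z.2)
      | z in [set: state * state]] <= ((4^-1) ^+ (k %/ tau))%:E)%E;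
  chain_display : measure_display;
  chain_space : measurableType chain_display;
  chain_prob : probability chain_space R;
  chain : nat -> {mfun chain_space >-> borel state};
  chain_markov : markov_chain trans invd chain_prob chain;
  oracle : 'rV[R]_d -> state -> R;
  oracle_measurable : measurable_fun [set: borel 'rV[R]_d * borel state]
    (fun w => oracle w.1 w.2);
  oracle_integrable :
    forall x, invd.-integrable [set: borel state] (EFin \o oracle x);
  objective : 'rV[R]_d -> R := fun x => fine 'E_invd[oracle x];
  objective_differentiable :
    forall x, differentiable (objective : 'rV[R]_d -> R^o) x;
  objective_smooth : exists2 L, 0 < L & lipschitz_gradient L objective;
  objective_strongly_convex : strongly_convex mu objective;
  oracle_variance : forall x,
    ('E_invd[(fun z => `|oracle x z - objective x| ^+ 2)%R]
     <= (sigma1 ^+ 2)%:E)%E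
}.

(* query k is the point of call k (numbered from 0), computed from the internal
   randomness and the k values already returned; only k < N is used. *)
Record one_point_algorithm (R : realType) (d N : nat) := {
  seed_display : measure_display;
  seed_space : measurableType seed_display;
  seed_prob : probability seed_space R;
  query : forall k : nat, seed_space * k.-tuple R -> 'rV[R]_d;
  query_measurable : forall k,
    measurable_fun [set: seed_space * k.-tuple R]
      (@query k : _ -> borel 'rV[R]_d);
  output : seed_space * N.-tuple R -> 'rV[R]_d;
  output_measurable :
    measurable_fun [set: seed_space * N.-tuple R]
      (output : _ -> borel 'rV[R]_d)
}.

Arguments query {R d N} a k _ : rename.
Arguments output {R d N} a _ : rename.
Arguments oracle {R d tau mu sigma1} I : rename.
Arguments objective {R d tau mu sigma1} I : rename.
Arguments chain {R d tau mu sigma1} I : rename.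

Fixpoint observations (R : realType) (d N : nat)
    (a : one_point_algorithm R d N) (Z : Type) (F : 'rV[R]_d -> Z -> R)
    (s : seed_space a) (z : nat -> Z) (k : nat) : k.-tuple R :=
  if k is k'.+1 then
    let y := observations F s z k' in
    [tuple of rcons y (F (query a k' (s, y)) (z k'))]
  else [tuple].

(* The product measure makes the internal randomness independent of the
   chain. *)
Definition mean_squared_error (R : realType) (d tau N : nat) (mu sigma1 : R)
    (a : one_point_algorithm R d N)
    (I : one_point_instance d tau mu sigma1) : \bar R :=
  (\int[seed_prob a \x chain_prob I]_w
    (enorm (output a (w.1, observations (oracle I) w.1
                                      (fun i => chain I i w.2) N)
            - minimizer (objective I)) ^+ 2)%:E)%E.

(* Main.v *)
Require Import Defs.
From HB Require Import structures.
From mathcomp Require Import all_boot all_order all_algebra.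
From mathcomp Require Import all_classical all_reals all_analysis.
From mathcomp Require Import measurable_realfun.
From mathcomp Require Import ring lra.

Set Implicit Arguments.
Unset Strict Implicit.
Unset Printing Implicit Defensive.

Import Order.TTheory GRing.Theory Num.Theory.
Import numFieldNormedType.Exports.

Local Open Scope classical_set_scope.
Local Open Scope ring_scope.

(** The lower bound is an Assouad argument over a cube of hard objectives.
    For a sign vector [w] in [{-1, 1}^d] let

      [f_w x = \sum_i (beta * curv / 2 * (x_i / theta)^2
                       + beta * w_i * g (x_i / theta))],  [g t = t / (1 + t^2)].

    Both [g] and its second derivative are bounded, so with
    [mu * theta^2 = beta] the quadratic part keeps [f_w] [mu]-strongly convex,
    and the minimizer has coordinates [- w_i * theta / 5].  Guessing a sign
    wrongly therefore costs about [theta^2], that is [beta / mu], and guessing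
    a constant fraction of the [d] signs wrongly costs [d * beta / mu].  On the
    other hand flipping a sign moves [f_w] by at most [2 * beta] everywhere, and
    since the Lipschitz constant of the gradient is not prescribed, [beta] may
    be as small as the number of calls [N] requires.

    The signs are hidden in the noise in two ways, according to which of [d]
    and [tau] is larger.

    If [tau <= d], the states are independent and a call at [x] returns one of
    only two values, [base x + sigma] and [base x - sigma], where [base] is the
    quadratic part.  The mean is [f_w x] when the up-probability is
    [(1 + rho * \sum_i w_i g (x_i / theta)) / 2] and [beta = sigma * rho].
    A call then carries a chi-square information of order [rho^2] about each
    sign, so [rho ~ 1 / sqrt N] is safe, and the error is at least of order
    [d * sigma / (mu * sqrt N)] ([iid_bound]).

    If [d < tau], the state is a pair of a direction [j] and a sign [b], kept
    with probability [1 - p] and redrawn with probability [p ~ 3 / tau]; a call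
    returns [base x + sigma * b * g (x_j / theta)].  However many queries are
    made while the state stays put, they reveal no more than the pair [(j, b)],
    in which [j] is uniform and [b] is a coin with bias [delta * w_j].  A draw
    carries information [delta^2 / d] about each sign and there are about
    [p * N] draws, so [delta^2 ~ d * tau / N] is safe.  Here
    [beta = sigma * delta / d], and the error is at least of order
    [sqrt (d * tau) * sigma / (mu * sqrt N)] ([block_bound]).

    In both cases the larger of [d] and [sqrt (d * tau)] is of the order of
    [sqrt (d * (d + tau))] ([lower_bound]).

    All chains are driven by independent letters, obtained from Lebesgue measure
    on the unit interval ([lebesgue_source]).  For a fixed internal randomness of
    the algorithm, its observations are a function of a process in which every
    new symbol depends on the past symbols and on one fresh letter ([adapted]).
    Along such a process the chi-square divergences of the single steps multiply,
    which gives the testing inequality [two_point] by induction on time;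
    summing it over the pairs of opposite vertices in each of the [d] directions
    gives [assouad].  Finally, the average over the cube and over the internal
    randomness is exchanged by Tonelli's theorem ([hard_instance_exists]). *)

(** * Euclidean norm and differentiability from a quadratic remainder *)
Section euclidean.
Context {R : realType} {d : nat}.
Implicit Types u v x y : 'rV[R]_d.

Lemma enorm_sqr u : enorm u ^+ 2 = \sum_(i < d) u ord0 i ^+ 2.
Proof.
rewrite sqr_sqrtr /dotv; last by apply: sumr_ge0 => i _; rewrite -expr2 sqr_ge0.
by apply: eq_bigr => i _; rewrite expr2.
Qed.

Lemma enorm_ge0 u : 0 <= enorm u.
Proof. exact: sqrtr_ge0. Qed.

Lemma enorm_eq0 u : enorm u ^+ 2 <= 0 -> u = 0.
Proof.
rewrite enorm_sqr => u0; apply/rowP => i; rewrite mxE; apply/eqP.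
have /eqP := le_anti (introT andP (conj u0 (sumr_ge0 _ (fun j _ => sqr_ge0 (u ord0 j))))).
by rewrite psumr_eq0 => [/allP/(_ i)|j _]; rewrite ?sqr_ge0// mem_index_enum sqrf_eq0 => /(_ isT).
Qed.

(** Differentials are taken with respect to the sup norm, remainders are bounded
    in the Euclidean one. *)
Lemma enorm_le_norm u : enorm u ^+ 2 <= d%:R * `|u| ^+ 2.
Proof.
rewrite enorm_sqr mulrC mulr_natr -[X in _ *+ X]card_ord -sumr_const.
apply: ler_sum => i _; rewrite -real_normK ?num_real// ler_sqr ?nnegrE//.
rewrite [leRHS]mx_normrE.
exact: (le_bigmax (0 : R) (fun ij : 'I_1 * 'I_d => `|u ij.1 ij.2|) (ord0, i)).
Qed.
End euclidean.

Section scalar_ripple.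
Context {R : realType}.
Implicit Types s t : R.

(** A bounded function with bounded second derivative and nonzero slope at the
    origin. *)
Definition ripple t : R := t / (1 + t ^+ 2).
Definition dripple t : R := (1 - t ^+ 2) / (1 + t ^+ 2) ^+ 2.

Lemma onesq_gt0 t : 0 < 1 + t ^+ 2.
Proof. by rewrite ltr_wpDr// sqr_ge0. Qed.

Lemma normr_ripple_le1 t : `|ripple t| <= 1.
Proof.
have t0 := onesq_gt0 t.
rewrite /ripple normrM normfV (gtr0_norm t0) ler_pdivrMr// mul1r ler_norml.
by apply/andP; split; nra.
Qed.

(** Dividing the remainder by [(s - t)^2] leaves an explicit rational function,
    so the bound on the second derivative is a polynomial inequality and needs
    no calculus. *)
Lemma ripple_remainder s t :
  `|ripple s - ripple t - dripple t * (s - t)| <= 3 / 2 * (s - t) ^+ 2.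
Proof.
have s0 := onesq_gt0 s; have t0 := onesq_gt0 t.
have -> : ripple s - ripple t - dripple t * (s - t) =
    - ((s - t) ^+ 2 * ((s * (1 - t ^+ 2) + 2 * t) /
        ((1 + t ^+ 2) ^+ 2 * (1 + s ^+ 2)))).
  by rewrite /ripple /dripple; field; rewrite !lt0r_neq0.
rewrite normrN normrM ger0_norm ?sqr_ge0// mulrC; apply: ler_wpM2r; first exact: sqr_ge0.
rewrite normrM normfV (@gtr0_norm _ ((1 + t ^+ 2) ^+ 2 * _)) ?mulr_gt0 ?exprn_gt0//.
rewrite ler_pdivrMr ?mulr_gt0 ?exprn_gt0//.
have num : `|s * (1 - t ^+ 2) + 2 * t| <= 3 / 2 * ((1 + t ^+ 2) * (1 + s ^+ 2)).
  have := sqr_ge0 (1 - s); have := sqr_ge0 (1 + s).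
  have := sqr_ge0 (1 - t); have := sqr_ge0 (1 + t).
  have := sqr_ge0 (t * (1 - s)); have := sqr_ge0 (t * (1 + s)).
  have := sqr_ge0 s; have := sqr_ge0 (s * t); have := sqr_ge0 t.
  rewrite !expr2 => *; rewrite ler_norml; apply/andP; split; lra.
apply: (le_trans num); rewrite ler_pM2l ?divr_gt0// ler_pM2r//.
by rewrite expr2 ler_pMr// lerDl sqr_ge0.
Qed.
End scalar_ripple.

Section quadratic_remainder.
Context {R : realType} {d : nat}.
Variables (f : 'rV[R]_d -> R^o) (G : 'rV[R]_d -> 'rV[R]_d) (C : R).
Hypothesis remainder : forall x y,
  `|f x - f y - dotv (G y) (x - y)| <= C * enorm (x - y) ^+ 2.

(* A remainder of order [|h|^2] is [o(h)], hence [G y] represents the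
   differential of [f] at [y]. *)
Let dG (y : 'rV[R]_d) : 'rV[R]_d -> R^o := dotv (G y).

Let dG_linear y : linear (dG y).
Proof.
move=> a u v; rewrite /dG /dotv scaler_sumr -big_split/=; apply: eq_bigr => i _.
by rewrite !mxE mulrDr mulrCA.
Qed.

HB.instance Definition _ y :=
  GRing.isLinear.Build R 'rV[R]_d R^o _ (dG y) (dG_linear y).

Let dG_continuous y : continuous (dG y).
Proof.
rewrite /dG /dotv; apply: (@continuous_big R^o _ _ _ _ add_continuous) => i _ x.
exact: (cvgM (@cvg_cst R^o _ _ _ _) (@coord_continuous _ _ _ ord0 i x)).
Qed.

Let dG_littleo y e : 0 < e -> \forall h \near (0 : 'rV[R]_d),
  `|(f \o shift y - (cst (f y) + dG y)) h| <= e * `|h|.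
Proof.
move=> e0.
pose K := `|C| * d%:R + 1.
have K0 : 0 < K by rewrite ltr_wpDl// mulr_ge0.
near=> h.
have -> : (f \o shift y - (cst (f y) + dG y)) h =
    f (h + y) - f y - dotv (G y) (h + y - y).
  by rewrite addrK /dG /= opprD addrA.
apply: (le_trans (remainder _ _)); rewrite addrK.
have hK : `|h| <= e / K.
  by near: h; have eK : 0 < e / K by [rewrite divr_gt0];
    exact: (@nbhs0_le _ 'rV[R]_d _ eK).
have : C * enorm h ^+ 2 <= K * `|h| ^+ 2.
  apply: (@le_trans _ _ (`|C| * (d%:R * `|h| ^+ 2))).
    apply: (@le_trans _ _ (`|C| * enorm h ^+ 2)).
      by rewrite ler_wpM2r ?sqr_ge0 ?ler_norm.
    by rewrite ler_wpM2l ?enorm_le_norm.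
  by rewrite mulrA ler_wpM2r ?sqr_ge0// lerDl.
move=> /le_trans; apply.
rewrite expr2 mulrA ler_wpM2r//.
by rewrite mulrC -ler_pdivlMr.
Unshelve. all: by end_near. Qed.

Let diff_dG y : 'd f y = dG y :> ('rV[R]_d -> R^o).
Proof.
by apply: diff_unique; [exact: dG_continuous|apply/eqaddoP; exact: dG_littleo].
Qed.

Lemma differentiable_of_remainder y : differentiable f y.
Proof.
apply/diff_locallyP; rewrite diff_dG.
by split; [exact: dG_continuous|apply/eqaddoP; exact: dG_littleo].
Qed.

Lemma gradient_of_remainder y : gradient f y = G y.
Proof.
apply/rowP => i; rewrite mxE.
rewrite diff_dG /dG /dotv.
rewrite (bigD1 i)//= big1 ?addr0 => [|j ji]; rewrite mxE eqxx/=.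
  by rewrite eqxx mulr1.
by rewrite (negbTE ji) mulr0.
Qed.

End quadratic_remainder.

(** * The hard objectives *)
Section hard_objective.
Context {R : realType} {d : nat}.
Variables (mu beta theta : R) (w : {ffun 'I_d -> bool}).
Hypotheses (mu0 : 0 < mu) (beta0 : 0 < beta) (theta0 : 0 < theta).
Hypothesis theta2 : mu * theta ^+ 2 = beta.
Implicit Types x y : 'rV[R]_d.

(** The vertices of the cube are Boolean functions; [true] stands for [-1]. *)
Definition signr (b : bool) : R := if b then -1 else 1.

(** [curv / 5] is the slope of [ripple] at [1 / 5], which puts the critical points
    of the two profiles [curv / 2 * t^2 + ripple t] and [curv / 2 * t^2 - ripple t]
    at [-1 / 5] and [1 / 5]; and [curv / 2 - 3 / 2] is still at least [1 / 2]. *)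
Definition curv : R := 750 / 169.

Definition signal x : R :=
  \sum_(i < d) signr (w i) * ripple (x ord0 i / theta).

Definition hard_base x : R := \sum_(i < d) beta * (curv / 2 * (x ord0 i / theta) ^+ 2).

Definition hard_obj x : R := hard_base x + beta * signal x.

Definition hard_grad x : 'rV[R]_d := \row_i
  (beta / theta * (curv * (x ord0 i / theta) +
                   signr (w i) * dripple (x ord0 i / theta))).

Definition hard_min : 'rV[R]_d := \row_i (- signr (w i) * (theta / 5)).

Lemma normr_signr b : `|signr b| = 1.
Proof. by case: b; rewrite /signr ?normrN normr1. Qed.

(* The first-order remainder of one profile; those of [hard_obj] are sums of
   rescaled copies of it. *)
Let phi (b : bool) (s t : R) := curv / 2 * s ^+ 2 + signr b * ripple s
    - (curv / 2 * t ^+ 2 + signr b * ripple t)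
    - (curv * t + signr b * dripple t) * (s - t).

Let phi_bounds b s t :
  (s - t) ^+ 2 / 2 <= phi b s t <= 4 * (s - t) ^+ 2.
Proof.
have : `|signr b * (ripple s - ripple t - dripple t * (s - t))| <= 3 / 2 * (s - t) ^+ 2.
  by rewrite normrM normr_signr mul1r ripple_remainder.
have -> : phi b s t = curv / 2 * (s - t) ^+ 2 +
    signr b * (ripple s - ripple t - dripple t * (s - t)) by rewrite /phi; field.
move: (signr b * _) => z; rewrite ler_norml => /andP[z1 z2].
have := sqr_ge0 (s - t); rewrite /curv; move: ((s - t) ^+ 2) z1 z2 => q z1 z2 q0.
by apply/andP; split; lra.
Qed.

Lemma hard_remainderE x y :
  hard_obj x - hard_obj y - dotv (hard_grad y) (x - y) =
  \sum_(i < d) beta * phi (w i) (x ord0 i / theta) (y ord0 i / theta).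
Proof.
rewrite /hard_obj /hard_base /signal /dotv !mulr_sumr -!big_split/= -!sumrB.
apply: eq_bigr => i _; rewrite !mxE /phi.
by field; rewrite lt0r_neq0.
Qed.

Let scale2 (a b : R) : beta * (a / theta - b / theta) ^+ 2 = mu * (a - b) ^+ 2.
Proof. by rewrite -theta2; field; rewrite lt0r_neq0. Qed.

Let phi_scaled c a b : mu / 2 * (a - b) ^+ 2 <=
  beta * phi c (a / theta) (b / theta) <= 4 * mu * (a - b) ^+ 2.
Proof.
have := phi_bounds c (a / theta) (b / theta); have := scale2 a b.
move: ((a / theta - _) ^+ 2) (phi _ _ _) ((a - b) ^+ 2) => S p D E.
rewrite -(ler_pM2l beta0 (S / 2)) -(ler_pM2l beta0 p) => /andP[p1 p2].
by apply/andP; split; lra.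
Qed.

Lemma hard_lower x y : mu / 2 * enorm (x - y) ^+ 2 <=
  hard_obj x - hard_obj y - dotv (hard_grad y) (x - y).
Proof.
rewrite hard_remainderE enorm_sqr mulr_sumr; apply: ler_sum => i _; rewrite !mxE.
by have /andP[] := phi_scaled (w i) (x ord0 i) (y ord0 i).
Qed.

Lemma hard_upper x y :
  hard_obj x - hard_obj y - dotv (hard_grad y) (x - y) <=
  4 * mu * enorm (x - y) ^+ 2.
Proof.
rewrite hard_remainderE enorm_sqr mulr_sumr; apply: ler_sum => i _; rewrite !mxE.
by have /andP[] := phi_scaled (w i) (x ord0 i) (y ord0 i).
Qed.

Lemma hard_remainder x y :
  `|hard_obj x - hard_obj y - dotv (hard_grad y) (x - y)| <=
  4 * mu * enorm (x - y) ^+ 2.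
Proof.
rewrite ger0_norm ?hard_upper//; apply: le_trans (hard_lower _ _).
by rewrite mulr_ge0 ?sqr_ge0// divr_ge0// ltW.
Qed.

Lemma hard_differentiable x : differentiable (hard_obj : 'rV[R]_d -> R^o) x.
Proof. exact: differentiable_of_remainder hard_remainder x. Qed.

Lemma hard_gradientE x : gradient hard_obj x = hard_grad x.
Proof. exact: gradient_of_remainder hard_remainder x. Qed.

Lemma hard_strongly_convex : strongly_convex mu hard_obj.
Proof. by move=> x y; rewrite hard_gradientE; exact: hard_lower. Qed.

(** Adding the remainders of a profile at [(s, t)] and at [(t, s)] leaves the
    difference of its derivatives times [s - t]. *)
Lemma hard_lipschitz : lipschitz_gradient (8 * mu) hard_obj.
Proof.
have mu8 : 0 <= 8 * mu by rewrite mulr_ge0// ltW.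
move=> x y; rewrite !hard_gradientE.
rewrite -ler_sqr ?nnegrE ?mulr_ge0 ?enorm_ge0 ?(ltW mu0)//.
rewrite exprMn !enorm_sqr mulr_sumr; apply: ler_sum => i _; rewrite !mxE.
set s := x ord0 i; set t := y ord0 i.
rewrite -exprMn -[leLHS]real_normK ?num_real// -[leRHS]real_normK ?num_real//.
rewrite ler_sqr ?nnegrE//.
have [<-|st] := eqVneq s t; first by rewrite !subrr mulr0.
have st0 : 0 < `|s - t| by rewrite normr_gt0 subr_eq0.
rewrite -(ler_pM2r st0).
rewrite -normrM.
have -> : (beta / theta * (curv * (s / theta) + signr (w i) * dripple (s / theta)) -
  beta / theta * (curv * (t / theta) + signr (w i) * dripple (t / theta))) * (s - t) =
  beta * phi (w i) (s / theta) (t / theta) + beta * phi (w i) (t / theta) (s / theta).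
  by rewrite /phi; field; rewrite lt0r_neq0.
rewrite [leRHS](_ : _ = 8 * mu * (s - t) ^+ 2); last first.
  by rewrite normrM (ger0_norm mu8) -mulrA -expr2 real_normK ?num_real.
have := phi_scaled (w i) s t; have := phi_scaled (w i) t s.
move: (beta * phi _ _ _) (beta * phi _ _ _) => p q.
have -> : (t - s) ^+ 2 = (s - t) ^+ 2 by ring.
have := mulr_ge0 (ltW mu0) (sqr_ge0 (s - t)); move: ((s - t) ^+ 2) => z m0.
move=> /andP[p1 p2] /andP[q1 q2].
have m2 : 0 <= mu / 2 * z by rewrite mulrAC divr_ge0.
by rewrite ger0_norm; lra.
Qed.

Lemma hard_grad_min : hard_grad hard_min = 0.
Proof.
apply/rowP => i; rewrite !mxE /dripple /curv.
have t0 : theta != 0 by rewrite lt0r_neq0.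
have -> : - signr (w i) * (theta / 5) / theta = - signr (w i) / 5.
  by field.
by case: (w i); rewrite /signr; field.
Qed.

(** At a critical point strong convexity bounds the squared distance by the gap in
    value, which gives both minimality and uniqueness. *)
Lemma minimizer_hard : minimizer hard_obj = hard_min.
Proof.
have low y : mu / 2 * enorm (y - hard_min) ^+ 2 <= hard_obj y - hard_obj hard_min.
  have := hard_lower y hard_min; rewrite hard_grad_min.
  by rewrite [dotv 0 _]big1 ?subr0// => i _; rewrite mxE mul0r.
have mu2 : 0 < mu / 2 by rewrite divr_gt0.
have : [set x | forall y, hard_obj x <= hard_obj y] (minimizer hard_obj).
  apply: getPex; exists hard_min => y /=; rewrite -subr_ge0.
  by apply: le_trans (low y); rewrite mulr_ge0 ?sqr_ge0// ltW.
move=> /(_ hard_min) minle.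
apply/eqP; rewrite -subr_eq0; apply/eqP/enorm_eq0.
rewrite -(pmulr_rle0 _ mu2); apply: (le_trans (low _)).
by rewrite subr_le0.
Qed.

End hard_objective.

(** * Processes driven by independent letters *)
Section countable_partition.
Context {dW : measure_display} {W : measurableType dW} {R : realType}.
Variable g : W -> nat.
Hypothesis mg : forall n, measurable (g @^-1` [set n]).

Lemma measurable_countable_preimage (S : set nat) : measurable (g @^-1` S).
Proof.
rewrite (_ : g @^-1` S = \bigcup_(n in S) (g @^-1` [set n])).
  by apply: bigcup_measurable => n _; exact: mg.
by apply/seteqP; split => [u Su|u [n Sn /= ->//]]; exists (g u).
Qed.

Lemma measure_partition (m : {measure set W -> \bar R}) (A : set W) :
  measurable A ->
  m A = (\sum_(0 <= n <oo) m (g @^-1` [set n] `&` A))%E.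
Proof.
move=> mA.
rewrite -measure_semi_bigcup//.
- congr (m _); apply/seteqP; split => [u Au|u [n _ []//]].
  by exists (g u).
- by move=> n; exact: measurableI.
- by move=> i j _ _ [u [[/= <- _] [/= <- _]]].
- by apply: bigcup_measurable => n _; exact: measurableI.
Qed.

Lemma measurable_fun_countable (dU : measure_display) (U : measurableType dU)
    (f : nat -> W -> U) :
  (forall n, measurable_fun setT (f n)) ->
  measurable_fun setT (fun x => f (g x) x).
Proof.
move=> mf _ B mB; rewrite setTI.
rewrite (_ : _ @^-1` B = \bigcup_n (g @^-1` [set n] `&` f n @^-1` B)).
  apply: bigcup_measurable => n _; apply: measurableI => //.
  by rewrite -[_ @^-1` B]setTI; exact: mf.
by apply/seteqP; split => [u Bu|u [n _ [/= <-]]//]; exists (g u).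
Qed.

End countable_partition.

(** An infinite sequence of independent letters of law [nu], presented by its
    self-similarity: the source splits into a letter and an independent copy of
    the source.  The sequence itself is [letter \o iter k shift_source]. *)
Record bernoulli_shift (R : realType) (nu : nat -> R) := {
  source_display : measure_display;
  source : measurableType source_display;
  source_prob : probability source R;
  letter : source -> nat;
  shift_source : source -> source;
  measurable_letter : forall n, measurable (letter @^-1` [set n]);
  measurable_shift_source : measurable_fun setT shift_source;
  letter_shift : forall n A, measurable A ->
    source_prob (letter @^-1` [set n] `&` shift_source @^-1` A) =
      ((nu n)%:E * source_prob A)%E
}.

Section adapted_process.
Context {R : realType} {nu : nat -> R} (S : bernoulli_shift nu).
Local Notation P := (source_prob S).
Local Notation xi := (@letter _ _ S).
Local Notation T := (@shift_source _ _ S).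

Lemma measurable_letter_in (B : set nat) : measurable (xi @^-1` B).
Proof. exact/measurable_countable_preimage/measurable_letter. Qed.

Lemma measurable_shift_preimage A : measurable A -> measurable (T @^-1` A).
Proof.
by move=> mA; rewrite -[_ @^-1` A]setTI; exact: measurable_shift_source.
Qed.

Lemma prob_letter n : P (xi @^-1` [set n]) = (nu n)%:E.
Proof.
by have := @letter_shift _ _ S n setT measurableT;
  rewrite preimage_setT setIT probability_setT mule1.
Qed.

Lemma letter_in_shift (B : set nat) A : measurable A ->
  P (xi @^-1` B `&` T @^-1` A) = (P (xi @^-1` B) * P A)%E.
Proof.
move=> mA.
have mB := measurable_letter_in B; have mTA := measurable_shift_preimage mA.
rewrite (measure_partition (@measurable_letter _ _ S)); last exact: measurableI.
rewrite [P (xi @^-1` B)](measure_partition (@measurable_letter _ _ S))//.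
have PA : P A = (fine (P A))%:E by rewrite fineK//; exact: fin_num_measure.
rewrite muleC PA -nneseriesZl//; apply: eq_eseriesr => n _; rewrite -PA.
have [Bn|nBn] := pselect (B n).
  rewrite setIA (_ : xi @^-1` [set n] `&` xi @^-1` B = xi @^-1` [set n]).
    by rewrite [X in (_ * X)%E]prob_letter muleC [LHS]letter_shift.
  by apply/seteqP; split => [u []//|u /= ->].
rewrite setIA (_ : xi @^-1` [set n] `&` xi @^-1` B = set0).
  by rewrite set0I !measure0 mule0.
by apply/seteqP; split => // u [/= ->].
Qed.

(** The process [v_k = r (v_0 ... v_(k-1)) letter_k].  Peeling off its first
    symbol, rather than the last one, matches [letter_shift] and lets its laws be
    computed by induction for all [r] at once; [adapted_rcons] recovers the
    description forward in time. *)
Fixpoint adapted (V : Type) (r : seq V -> nat -> V) n (u : source S) : seq V :=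
  if n is n'.+1 then
    let v := r [::] (xi u) in v :: adapted (fun h => r (v :: h)) n' (T u)
  else [::].

Lemma size_adapted (V : Type) (r : seq V -> nat -> V) n u :
  size (adapted r n u) = n.
Proof. by elim: n r u => //= n IH r u; rewrite IH. Qed.

Lemma adapted_rcons (V : Type) (r : seq V -> nat -> V) n u :
  adapted r n.+1 u =
  rcons (adapted r n u) (r (adapted r n u) (xi (iter n T u))).
Proof.
elim: n r u => [//|n IH] r u.
apply: etrans (congr1 (cons _) (IH _ (T u))) _.
by rewrite -iterSr.
Qed.

Fixpoint path_weight (V : Type) (q : seq V -> V -> R) (b : seq V) : R :=
  if b is v :: b' then q [::] v * path_weight (fun h => q (v :: h)) b' else 1.

Definition letter_law (V : Type) (r : seq V -> nat -> V) (h : seq V) (v : V) : R :=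
  fine (P [set u | r h (xi u) = v]).

Lemma adapted_cons (V : Type) (r : seq V -> nat -> V) n (v : V) (b : seq V) :
  [set u | adapted r n.+1 u = v :: b] =
  xi @^-1` [set e | r [::] e = v] `&`
  T @^-1` [set u | adapted (fun h => r (v :: h)) n u = b].
Proof. by apply/seteqP; split => u /= [<-]// <-. Qed.

Lemma measurable_adapted (V : Type) (r : seq V -> nat -> V) n (b : seq V) :
  measurable [set u : source S | adapted r n u = b].
Proof.
elim: n r b => [|n IH] r [|v b] /=.
- rewrite (_ : mkset _ = setT); first exact: measurableT.
  by apply/seteqP; split.
- rewrite (_ : mkset _ = set0); first exact: measurable0.
  by apply/seteqP; split.
- rewrite (_ : mkset _ = set0); first exact: measurable0.
  by apply/seteqP; split.
- rewrite [X in measurable X](@adapted_cons V r n v b).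
  apply: measurableI; first exact: measurable_letter_in.
  by apply: measurable_shift_preimage; exact: IH.
Qed.

(** What remains of the source after [n] letters is independent of the first [n]
    symbols and has the law of the source. *)
Lemma adapted_shift (V : Type) (r : seq V -> nat -> V) (b : seq V) A :
  measurable A ->
  P ([set u | adapted r (size b) u = b] `&` iter (size b) T @^-1` A) =
    ((path_weight (letter_law r) b)%:E * P A)%E.
Proof.
move=> mA; elim: b r => [|v b IH] r.
  by rewrite mul1e (_ : mkset _ = setT) ?setTI//; apply/seteqP; split.
have -> : [set u | adapted r (size (v :: b)) u = v :: b] `&`
    iter (size (v :: b)) T @^-1` A =
    xi @^-1` [set e | r [::] e = v] `&` T @^-1`
    ([set u | adapted (fun h => r (v :: h)) (size b) u = b] `&`
     iter (size b) T @^-1` A).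
  rewrite [X in X `&` _](@adapted_cons V r (size b) v b) preimage_setI setIA.
  by congr (_ `&` _); apply/seteqP; split => u /=; rewrite -iterS iterSr.
rewrite letter_in_shift; last first.
  apply: measurableI; first exact: measurable_adapted.
  by elim: (size b) A mA {IH} => //= n IH A mA; apply/(IH (T @^-1` A))/measurable_shift_preimage.
rewrite IH /= EFinM muleA; congr (_ * _ * _)%E.
rewrite /letter_law fineK//; apply: fin_num_measure.
exact: (measurable_letter_in [set e | r [::] e = v]).
Qed.

Lemma adapted_law (V : Type) (r : seq V -> nat -> V) (b : seq V) :
  P [set u | adapted r (size b) u = b] = (path_weight (letter_law r) b)%:E.
Proof.
have := adapted_shift r b measurableT.
by rewrite preimage_setT setIT probability_setT mule1.
Qed.

End adapted_process.

(** A point of the unit interval, cut into consecutive cells of lengths [nu n],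
    picks the letter of its cell; its position inside that cell, rescaled to the
    unit interval, is the rest of the source.  Independence is the behaviour of
    Lebesgue measure under affine maps. *)
Section lebesgue_source.
Context {R : realType} (nu : nat -> R).
Hypothesis nu0 : forall n, 0 <= nu n.

Definition cumul n : R := \sum_(i < n) nu i.

Hypothesis cumul_le1 : forall n, cumul n <= 1.
Hypothesis cumul_sup : forall e, 0 < e -> exists n, 1 - e < cumul n.

Local Notation W := (measurableTypeR R).
Local Notation leb := (@lebesgue_measure R).

Let cumulS n : cumul n.+1 = cumul n + nu n.
Proof. by rewrite /cumul big_ord_recr. Qed.

Let cumul_mono m n : (m <= n)%N -> cumul m <= cumul n.
Proof.
move=> /subnK <-; elim: (n - m)%N => [//|k IH]; rewrite addSn cumulS.
by rewrite ler_wpDr.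
Qed.

Let cell n : set R := [set` `[cumul n, cumul n.+1[].

Let in_cell n u : cell n u <-> cumul n <= u < cumul n.+1.
Proof. by rewrite /cell/= in_itv/=. Qed.

Let cell_inj m n u : cell m u -> cell n u -> m = n.
Proof.
move=> /in_cell/andP[m1 m2] /in_cell/andP[n1 n2].
apply/eqP; rewrite eqn_leq; apply/andP; split; rewrite leqNgt; apply/negP => mn.
- by have := lt_le_trans n2 (le_trans (cumul_mono mn) m1); rewrite ltxx.
- by have := lt_le_trans m2 (le_trans (cumul_mono mn) n1); rewrite ltxx.
Qed.

Let cell_cover u : 0 <= u < 1 -> exists n, cell n u.
Proof.
move=> /andP[u0 u1].
have ex : exists n, u < cumul n.
  have [|n] := @cumul_sup (1 - u); first by rewrite subr_gt0.
  by rewrite subKr => ?; exists n.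
case: (ex_minnP ex) => -[|n] un minn.
  by move: un; rewrite /cumul big_ord0 ltNge u0.
exists n; apply/in_cell; rewrite un andbT leNgt; apply/negP => /minn.
by rewrite ltnn.
Qed.

Let digit (u : W) : nat := xget 0%N [set n | cell n u].

Let digit_cell n u : cell n u -> digit u = n.
Proof.
by move=> nu_; rewrite /digit; case: xgetP => [m _ /= mu|/(_ n)//]; exact: cell_inj mu nu_.
Qed.

Let measurable_cell n : measurable (cell n : set W).
Proof. exact: measurable_itv. Qed.

Let measurable_digit n : measurable (digit @^-1` [set n]).
Proof.
rewrite (_ : digit @^-1` [set n] =
    (cell n `|` (if n == 0%N then ~` \bigcup_k cell k else set0)) :> set W).
  apply: measurableU; first exact: measurable_cell.
  case: ifP => _; last exact: measurable0.
  apply: measurableC; apply: bigcup_measurable => k _; exact: measurable_cell.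
apply/seteqP; split => [u /= un|u [/digit_cell//|]].
  move: un; rewrite /digit; case: xgetP => [m _ /= mu <-|none <-]; first by left.
  by right; rewrite eqxx => -[k _ ku]; exact: none ku.
case: ifP => // /eqP -> none.
rewrite /= /digit; case: xgetP => // m _ /= mu; case: none; by exists m.
Qed.

Let rescale n (u : W) : W := (u - cumul n) / nu n.

Let measurable_rescale n : measurable_fun setT (rescale n).
Proof.
by apply: measurable_funM => //; apply: measurable_funB.
Qed.

Let remainder (u : W) : W := rescale (digit u) u.

Let measurable_remainder : measurable_fun setT remainder.
Proof. exact: (measurable_fun_countable measurable_digit measurable_rescale). Qed.

Let unit_itv : set W := [set` `[0, 1[].

Let measurable_unit : measurable unit_itv.
Proof. exact: measurable_itv. Qed.

Definition unit_lebesgue : set W -> \bar R := mrestr leb measurable_unit.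

HB.instance Definition _ := Measure.on unit_lebesgue.

Let unit_lebesgueT : unit_lebesgue setT = 1%E.
Proof.
rewrite /unit_lebesgue /mrestr setTI [LHS]lebesgue_measure_itv/= lte_fin ltr01.
by rewrite sube0.
Qed.

HB.instance Definition _ :=
  Measure_isProbability.Build _ _ _ unit_lebesgue unit_lebesgueT.

Let affine (a b : R) (v : W) : W := a + b * v.

Let lebesgue_affine (a b : R) (B : set W) : 0 < b -> measurable B ->
  leb B = (b%:E * leb (affine a b @^-1` B))%E.
Proof.
move=> b0 mB.
have mf : measurable_fun setT (affine a b).
  by apply: measurable_funD => //; apply: measurable_funM.
rewrite (@lebesgue_measure_unique _ (mscale (NngNum (ltW b0)) (pushforward leb (affine a b))))//.
move=> _ [[x y] _ <-] /=.
rewrite /mscale /= /pushforward.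
rewrite (_ : _ @^-1` _ = [set` `](x - a) / b, (y - a) / b]]); last first.
  apply/seteqP; split => u /=; rewrite !in_itv/= ltr_pdivrMr// ler_pdivlMr//.
    by rewrite ltrBlDl lerBrDl [u * b]mulrC.
  by rewrite ltrBlDl lerBrDl [u * b]mulrC.
rewrite [LHS]lebesgue_measure_itv [X in (_ * X)%E]lebesgue_measure_itv /= !lte_fin.
rewrite ltr_pM2r ?invr_gt0// ltrD2r.
case: ifP => _; last by rewrite mule0.
rewrite -!EFinD -EFinM; congr _%:E.
by field; rewrite lt0r_neq0.
Qed.

Let digit_remainder n A : measurable A ->
  unit_lebesgue (digit @^-1` [set n] `&` remainder @^-1` A) =
  ((nu n)%:E * unit_lebesgue A)%E.
Proof.
move=> mA; rewrite /unit_lebesgue /mrestr.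
have -> : (digit @^-1` [set n] `&` remainder @^-1` A) `&` unit_itv =
    cell n `&` rescale n @^-1` A.
  apply/seteqP; split => u /=.
    move=> [[dn Au]]; rewrite /unit_itv/= in_itv/= => /cell_cover[m mu].
    have nu_ : cell n u by rewrite -dn (digit_cell mu).
    by split => //; move: Au; rewrite /remainder dn.
  move=> [nu_ Au]; rewrite /remainder (digit_cell nu_); split => //.
  move: nu_ => /in_cell/andP[u1 u2]; rewrite /unit_itv/= in_itv/=; apply/andP; split.
    by apply: le_trans u1; rewrite /cumul sumr_ge0.
  exact: lt_le_trans u2 _.
have [nun|nun] := eqVneq (nu n) 0.
  rewrite nun mul0e (_ : cell n = set0) ?set0I ?measure0//.
  by rewrite /cell cumulS nun addr0 set_itvco0.
have nun0 : 0 < nu n by rewrite lt_neqAle eq_sym nun nu0.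
rewrite (lebesgue_affine (cumul n) nun0); last first.
  apply: measurableI; first exact: measurable_cell.
  by rewrite -[_ @^-1` _]setTI; exact: measurable_rescale.
congr (_ * leb _)%E; apply/seteqP; split => v /=.
  rewrite /cell /rescale /unit_itv /affine /= !in_itv/= cumulS => -[/andP[v0 v1]].
  rewrite addrAC subrr add0r mulrAC mulfV// mul1r => Av; split => //.
  move: v0 v1; rewrite lerDl ltrD2l pmulr_rge0// -[X in _ < X]mulr1 ltr_pM2l//.
  by move=> -> ->.
rewrite /cell /rescale /unit_itv /affine /= !in_itv/= cumulS => -[Av /andP[v0 v1]].
rewrite addrAC subrr add0r mulrAC mulfV// mul1r; split => //.
by rewrite lerDl ltrD2l pmulr_rge0// -[X in _ < X]mulr1 ltr_pM2l// v0.
Qed.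

Definition lebesgue_source : bernoulli_shift nu :=
  {| source_prob := unit_lebesgue;
     measurable_letter := measurable_digit;
     measurable_shift_source := measurable_remainder;
     letter_shift := digit_remainder |}.

End lebesgue_source.

(** * Markov chains on a discrete state space *)
(** The parameter is the codomain of the distance, which the metric instance has to
    determine from the type. *)
Definition discrete_nat (R : realType) : Type := nat.

HB.instance Definition _ (R : realType) := Choice.copy (discrete_nat R) nat.
HB.instance Definition _ (R : realType) := Pointed.copy (discrete_nat R) nat.

Section discrete_metric.
Context {R : realType}.
Implicit Types x y z : discrete_nat R.

Definition discrete_dist x y : R := (x != y)%:R.

Let dist_xx x : discrete_dist x x = 0.
Proof. by rewrite /discrete_dist eqxx. Qed.

Let dist_eq x y : discrete_dist x y = 0 -> x = y.
Proof. by rewrite /discrete_dist; case: eqVneq => //= _ /eqP; rewrite oner_eq0. Qed.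

Let dist_sym x y : discrete_dist x y = discrete_dist y x.
Proof. by rewrite /discrete_dist eq_sym. Qed.

Let dist_triangle y x z : discrete_dist x z <= discrete_dist x y + discrete_dist y z.
Proof.
rewrite /discrete_dist; have [->|xy] := eqVneq x y; first by rewrite add0r.
by case: eqP => _ /=; rewrite ?addr_ge0// lerDl.
Qed.

HB.instance Definition _ := isMetric.Build R (discrete_nat R)
  dist_xx dist_eq dist_sym dist_triangle.

Lemma ball_discrete_nat x e : 0 < e <= 1 -> ball x e = [set x].
Proof.
move=> /andP[e0 e1]; rewrite ballEmdist; apply/seteqP; split => y /=.
  rewrite /mdist/= /discrete_dist; case: eqVneq => //= _ /lt_le_trans => /(_ _ e1).
  by rewrite ltxx.
by move=> ->; rewrite /mdist/= /discrete_dist eqxx.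
Qed.

Lemma nbhs_discrete_nat x : nbhs x [set x].
Proof.
apply/nbhs_ballP; exists 1 => //=; rewrite ball_discrete_nat//.
by rewrite ltr01 lexx.
Qed.

Lemma open_discrete_nat (A : set (discrete_nat R)) : open A.
Proof.
rewrite openE => x Ax; apply: filterS (nbhs_discrete_nat x).
by move=> y ->.
Qed.

Let complete_discrete_nat (F : set_system (discrete_nat R)) :
  ProperFilter F -> cauchy F -> cvg F.
Proof.
move=> FF /(@cauchyP R _ F FF) /(_ 1 ltr01) [x Fx].
apply/cvg_ex; exists x; apply/(@cvg_ballP R) => e e0.
move: Fx; rewrite /= (@ball_discrete_nat x 1) ?ltr01 ?lexx// => Fx.
by apply: filterS Fx => y ->; exact: ballxx.
Qed.

HB.instance Definition _ := Uniform_isComplete.Build (discrete_nat R) complete_discrete_nat.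

Lemma measurable_discrete_nat (A : set (borel (discrete_nat R))) : measurable A.
Proof. by apply: sub_sigma_algebra; exact: open_discrete_nat. Qed.

Lemma separable_discrete_nat : separable (discrete_nat R).
Proof.
exists setT; first exact: (@countableP nat).
by move=> A A0 _; rewrite setIT.
Qed.

End discrete_metric.

Section total_variation.
Context {dT : measure_display} {T : measurableType dT} {R : realType}.

(** On a Hahn decomposition into [U] and [V] the variation of [m1 - m2] is
    [(m1 - m2) U + (m2 - m1) V]. *)
Lemma tv_dist_le (m1 m2 : {finite_measure set T -> \bar R}) (e : R) :
  (forall A, measurable A -> m1 A <= m2 A + e%:E)%E ->
  (forall A, measurable A -> m2 A <= m1 A + e%:E)%E ->
  ((2^-1)%:E * tv_dist m1 m2 <= e%:E)%E.
Proof.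
move=> m12 m21; rewrite /tv_dist /tv_norm.
move: (cid (Hahn_decomposition _)) => [P [N H]] /=.
case: (cid _) => {}N {}H /=.
rewrite /charge_variation /= jordan_posE jordan_negE cjordan_posE cjordan_negE.
have mT : measurable [set: T] by exact: measurableT.
rewrite /crestr0 !(mem_set mT).
have [[mP _] [mN _] _ _] := H.
rewrite /crestr !setTI /= /cadd /copp /=.
have finm (m : {finite_measure set T -> \bar R}) A : measurable A -> m A \is a fin_num.
  exact: fin_num_measure.
rewrite -lee_pdivlMl// invrK -EFinM.
rewrite -[copp _ P]/(- m2 P)%E -[copp _ N]/(- m2 N)%E.
have := m12 P mP; have := m21 N mN.
rewrite /charge_of_finite_measure /=.
rewrite -(fineK (finm m1 P mP)) -(fineK (finm m2 P mP)).
rewrite -(fineK (finm m1 N mN)) -(fineK (finm m2 N mN)).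
rewrite -!EFinD !lee_fin => h1 h2.
lra.
Qed.

End total_variation.

(** The chain with initial state [init letter_0] and [Z_(k+1) = upd Z_k
    letter_(k+1)]. *)
Section random_mapping_chain.
Context {R : realType} {nu : nat -> R} (S : bernoulli_shift nu).
Variables (init : nat -> nat) (upd : nat -> nat -> nat).
Local Notation P := (source_prob S).
Local Notation xi := (@letter _ _ S).
Local Notation T := (@shift_source _ _ S).
Local Notation Z := (borel (discrete_nat R)).

Lemma measurable_to_discrete (dX : measure_display) (X : measurableType dX)
    (f : Z -> X) : measurable_fun setT f.
Proof. by move=> _ B _; rewrite setTI; exact: measurable_discrete_nat. Qed.

Let init_letter (u : source S) : Z := init (xi u).

Let measurable_init_letter : measurable_fun setT init_letter.
Proof.
by move=> _ B _; rewrite setTI; exact: (measurable_letter_in S (init @^-1` B)).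
Qed.

Let upd_letter (z : Z) (u : source S) : Z := upd z (xi u).

Let measurable_upd_letter z : measurable_fun setT (upd_letter z).
Proof.
by move=> _ B _; rewrite setTI; exact: (measurable_letter_in S (upd z @^-1` B)).
Qed.

HB.instance Definition _ := isMeasurableFun.Build _ _ _ _ init_letter measurable_init_letter.
HB.instance Definition _ z := isMeasurableFun.Build _ _ _ _ (upd_letter z) (measurable_upd_letter z).

Definition init_law : probability Z R := distribution P init_letter.

Definition upd_kernel (z : Z) : {measure set Z -> \bar R} :=
  distribution P (upd_letter z).

HB.instance Definition _ := isKernel.Build _ _ _ _ _ upd_kernel
  (fun U _ => measurable_to_discrete (upd_kernel ^~ U)).

Let upd_kernelT z : upd_kernel z setT = 1%E.
Proof. exact: probability_setT. Qed.

HB.instance Definition _ := Kernel_isProbability.Build _ _ _ _ _ upd_kernel upd_kernelT.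

Definition trans_kernel : R.-pker Z ~> Z := upd_kernel.

Lemma trans_kernelE z A : trans_kernel z A = P (xi @^-1` (upd z @^-1` A)).
Proof. by []. Qed.

Lemma init_lawE A : init_law A = P (xi @^-1` (init @^-1` A)).
Proof. by []. Qed.

Definition run (e : seq nat) : nat :=
  if e is l :: e' then foldl upd (init l) e' else init 0.

Lemma run_rcons e l : e != [::] -> run (rcons e l) = upd (run e) l.
Proof. by case: e => // l' e _; rewrite /= foldl_rcons. Qed.

Definition word n (u : source S) : seq nat := adapted (fun _ => id) n u.

Lemma wordS n u : word n.+1 u = rcons (word n u) (xi (iter n T u)).
Proof. exact: adapted_rcons. Qed.

Lemma size_word n u : size (word n u) = n.
Proof. exact: size_adapted. Qed.

Let code n (u : source S) := pickle (word n u).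

Let measurable_code n k : measurable (code n @^-1` [set k]).
Proof.
have [ek|nk] := pselect (exists e : seq nat, pickle e = k).
  case: ek => e <-; rewrite (_ : _ @^-1` _ = [set u | word n u = e]).
    exact: measurable_adapted.
  apply/seteqP; split => u /=; last by rewrite /code => ->.
  by rewrite /code => /(pcan_inj pickleK).
rewrite (_ : _ @^-1` _ = set0); first exact: measurable0.
by apply/seteqP; split => // u /= uk; apply: nk; exists (word n u).
Qed.

Lemma measurable_word n (B : set (seq nat)) : measurable (word n @^-1` B).
Proof.
rewrite (_ : _ @^-1` _ = code n @^-1` [set k | exists2 e, B e & pickle e = k]).
  exact: measurable_countable_preimage (measurable_code n) _.
apply/seteqP; split => [u Bu|u [e Be /(pcan_inj pickleK) eu]] /=.
  by exists (word n u).
by rewrite -eu.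
Qed.

Let state_at n (u : source S) : Z := run (word n.+1 u).

Let measurable_state_at n : measurable_fun setT (state_at n).
Proof.
by move=> _ B _; rewrite setTI; exact: (measurable_word n.+1 (run @^-1` B)).
Qed.

HB.instance Definition _ n := isMeasurableFun.Build _ _ _ _ (state_at n) (measurable_state_at n).

Definition mapping_chain (n : nat) : {mfun source S >-> Z} := state_at n.

Lemma mapping_chainE n u : mapping_chain n u = run (word n.+1 u).
Proof. by []. Qed.

Lemma mapping_chainS n u :
  mapping_chain n.+1 u = upd (mapping_chain n u) (xi (iter n.+1 T u)).
Proof.
by rewrite !mapping_chainE wordS run_rcons.
Qed.

(* The past of the chain is described without generators: an event of the
   sigma-algebra of [Z_0 ... Z_n] is a union of cells of constant word, and there
   are countably many cells. *)
Let saturated n (A : set (source S)) :=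
  forall u v, word n u = word n v -> A u -> A v.

Let past_saturated n A :
  g_sigma_preimage (fun (i : 'I_n.+1) => mapping_chain i : source S -> Z) A ->
  saturated n.+1 A.
Proof.
have word_prefix m u v : (m <= n.+1)%N -> word n.+1 u = word n.+1 v ->
    word m u = word m v.
  move=> /subnK <-; elim: (n.+1 - m)%N => [//|k IH]; rewrite addSn.
  by rewrite !wordS => /rcons_inj[/IH].
have sigma : sigma_algebra setT (saturated n.+1).
  split.
  - by move=> u v _.
  - by move=> B sB u v uv [_ nBu]; split => // Bv; apply: nBu; exact: sB Bv.
  - by move=> F sF u v uv [k _ Fk]; exists k => //; exact: sF Fk.
apply: smallest_sub => //.
move=> B.
rewrite -bigcup_mkord_ord => -[i Ii [D mD <-]] u v uv [_ Du]; split => //.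
move: Du; rewrite /preimage/= /mapping_chain /state_at.
by rewrite (word_prefix _ u v).
Qed.

Lemma cell_next n e D : size e = n ->
  P (word n @^-1` [set e] `&` iter n T @^-1` (xi @^-1` D)) =
  (P (word n @^-1` [set e]) * P (xi @^-1` D))%E.
Proof.
move=> <-; have mD := measurable_letter_in S D.
have := adapted_shift (fun _ => id) e mD; rewrite -adapted_law => <-.
by [].
Qed.

(** On a cell of constant word the state is constant and the next letter is
    independent of the cell, so the two sides agree cell by cell. *)
Lemma markov_mapping_chain : markov_chain trans_kernel init_law P mapping_chain.
Proof.
split=> [A mA|n A B pA mB]; first by [].
have satA := past_saturated pA.
have mA : measurable A.
  rewrite (_ : A = word n.+1 @^-1` (word n.+1 @` A)); first exact: measurable_word.
  by apply/seteqP; split => [u Au|u [v Av /satA]]; [exists u|exact].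
have mX : measurable (mapping_chain n.+1 @^-1` B).
  by rewrite -[_ @^-1` _]setTI; exact: measurable_funPT.
have mAX : measurable (A `&` mapping_chain n.+1 @^-1` B) by exact: measurableI.
rewrite (measure_partition (measurable_code n.+1) P mAX).
rewrite [in RHS](_ : A = \bigcup_k (code n.+1 @^-1` [set k] `&` A)); last first.
  by apply/seteqP; split => [u Au|u [k _ []//]]; exists (code n.+1 u).
rewrite ge0_integral_bigcup//.
- apply: eq_eseriesr => k _.
  rewrite setIA.
  have [[u [uk Au]]|none] := pselect ((code n.+1 @^-1` [set k] `&` A) !=set0); last first.
    have -> : code n.+1 @^-1` [set k] `&` A = set0.
      by apply/seteqP; split => // u uA; apply: none; exists u.
    by rewrite set0I measure0 integral_set0.
  have cellE : code n.+1 @^-1` [set k] `&` A = word n.+1 @^-1` [set word n.+1 u].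
    apply/seteqP; split => v /=.
      by move=> [vk _]; apply: (pcan_inj pickleK); rewrite -/(code n.+1 v) vk.
    by move=> vu; split; [rewrite /code vu|exact: satA Au].
  rewrite cellE (eq_integral (cst (trans_kernel (run (word n.+1 u)) B))); last first.
    by move=> v; rewrite inE /= => vu; rewrite mapping_chainE vu.
  rewrite integral_cst; last exact: measurable_word.
  rewrite trans_kernelE muleC -(cell_next _ (size_word n.+1 u)).
  congr (P _); apply/seteqP; split => v [/= vu].
    by rewrite mapping_chainS mapping_chainE vu.
  by rewrite mapping_chainS mapping_chainE vu.
- by move=> k; apply: measurableI => //; exact: measurable_code.
- apply: measurable_funTS.
  exact: (measurableT_comp (measurable_to_discrete (fun z => trans_kernel z B))
    (measurable_funPT (mapping_chain n))).
- by move=> i j _ _ [u [[/= <- _] [/= <- _]]].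
Qed.

End random_mapping_chain.

(** Chains that keep their state with probability [1 - p] and redraw it from the
    initial law otherwise.  That law is then invariant, and the only invariant one
    because [p > 0]; after [k] steps the starting point survives with probability
    [(1 - p) ^+ k], which bounds the distance between two starting points. *)
Section lazy_mapping.
Context {R : realType} {nu : nat -> R} (S : bernoulli_shift nu).
Variables (init : nat -> nat) (upd : nat -> nat -> nat) (p : R).
Local Notation Z := (borel (discrete_nat R)).
Local Notation Q := (trans_kernel S upd).
Local Notation pi := (init_law S init).

Definition lazy_mapping := forall (z : Z) (A : set Z),
  (Q z A = (1 - p)%:E * \d_z A + p%:E * pi A)%E.

Hypotheses (p_gt0 : 0 < p) (p_le1 : p <= 1) (lazyQ : lazy_mapping).

Lemma integral_lazy (m : probability Z R) (A : set Z) :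
  (\int[m]_z Q z A = (1 - p)%:E * m A + p%:E * pi A)%E.
Proof.
have mA := measurable_discrete_nat A.
under eq_integral do rewrite lazyQ.
have p1 : 0 <= 1 - p by rewrite subr_ge0.
rewrite ge0_integralD//; last 3 first.
- by move=> z _; rewrite mule_ge0.
- exact: measurable_to_discrete.
- by move=> z _; rewrite mule_ge0// lee_fin ltW.
rewrite ge0_integralZl_EFin//; last exact: measurable_to_discrete.
under eq_integral do rewrite diracE.
rewrite [X in (_ + X)%E]integral_cst; last exact: measurableT.
congr (_ * _ + _)%E; last first.
  by rewrite -[RHS]mule1; congr (_ * _)%E; exact: probability_setT.
rewrite (eq_integral (fun z : Z => (\1_A z)%:E)); last by move=> z _.
by rewrite integral_indic// setIT.
Qed.

Lemma invariant_lazy : Defs.invariant Q pi.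
Proof.
move=> A mA.
have pf : pi A \is a fin_num by exact: fin_num_measure.
rewrite integral_lazy -(fineK pf) -!EFinM -EFinD; congr _%:E; ring.
Qed.

Lemma invariant_lazy_unique (m : probability Z R) :
  Defs.invariant Q m -> forall A, measurable A -> m A = pi A.
Proof.
move=> inv A mA; have := inv A mA; rewrite integral_lazy.
have mf : m A \is a fin_num by exact: fin_num_measure.
have pf : pi A \is a fin_num by exact: fin_num_measure.
rewrite -(fineK mf) -(fineK pf) -!EFinM -EFinD => -[E]; congr _%:E.
have : p * (fine (pi A) - fine (m A)) = 0 by lra.
by move/eqP; rewrite mulf_eq0 gt_eqF//= subr_eq0 => /eqP.
Qed.

Lemma kpow_lazy k (z : Z) (A : set Z) :
  (kpow Q k z A = ((1 - p) ^+ k)%:E * \d_z A + (1 - (1 - p) ^+ k)%:E * pi A)%E.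
Proof.
elim: k z A => [|k IH] z A.
  by rewrite expr0 subrr mul0e adde0 mul1e.
transitivity ((1 - p)%:E * kpow Q k z A + p%:E * pi A)%E.
  exact: (integral_lazy (kernel_at (kpow Q k) z) A).
rewrite IH diracE.
have pf : pi A \is a fin_num by apply: fin_num_measure; exact: measurable_discrete_nat.
rewrite -(fineK pf) -?EFinM -?EFinD -?EFinM -?EFinD -?EFinM -?EFinD exprS; congr _%:E.
by ring.
Qed.

Lemma mixing_lazy tau : (0 < tau)%N -> (1 - p) ^+ tau <= 4^-1 -> forall k : nat,
  (ereal_sup [set (2^-1)%:E *
      tv_dist (kernel_at (kpow Q k) z.1) (kernel_at (kpow Q k) z.2)
    | z in [set: Z * Z]] <= ((4^-1) ^+ (k %/ tau))%:E)%E.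
Proof.
move=> tau0 ptau k; apply: ge_ereal_sup => _ [[z z'] _ <-] /=.
have p1 : 0 <= 1 - p by rewrite subr_ge0.
have pk0 j : 0 <= (1 - p) ^+ j by rewrite exprn_ge0.
have pk : (1 - p) ^+ k <= 4^-1 ^+ (k %/ tau).
  rewrite {1}(divn_eq k tau) exprD -[leRHS]mulr1; apply: ler_pM => //.
    by rewrite mulnC exprM lerXn2r ?nnegrE ?invr_ge0.
  by rewrite exprn_ile1// gerBl ltW.
have le (y y' : Z) A : (kernel_at (kpow Q k) y A <=
    kernel_at (kpow Q k) y' A + (4^-1 ^+ (k %/ tau))%:E)%E.
  rewrite /kernel_at !kpow_lazy !diracE.
  have pf : pi A \is a fin_num by apply: fin_num_measure; exact: measurable_discrete_nat.
  rewrite -(fineK pf) -!EFinM -!EFinD lee_fin.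
  move: (pk0 k) pk; move: ((1 - p) ^+ k) (_ ^+ (k %/ _)) (_ * fine _) => a b c a0 ab.
  by case: (y \in A); case: (y' \in A); rewrite /= ?mulr0 ?mulr1; lra.
by apply: tv_dist_le => A _; exact: le.
Qed.

End lazy_mapping.

(** * Instances built from lazy chains *)
Section instance_of_lazy_mapping.
Context {R : realType} {d tau : nat} {mu sigma : R} {nu : nat -> R}.
Variables (S : bernoulli_shift nu) (init : nat -> nat) (upd : nat -> nat -> nat).
Variables (p : R) (F : 'rV[R]_d -> nat -> R) (base f : 'rV[R]_d -> R).
Local Notation Z := (borel (discrete_nat R)).
Local Notation pi := (init_law S init).

Hypotheses (tau0 : (0 < tau)%N) (sigma0 : 0 < sigma).
Hypotheses (p_gt0 : 0 < p) (p_le1 : p <= 1) (ptau : (1 - p) ^+ tau <= 4^-1).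
Hypothesis lazyQ : lazy_mapping S init upd p.
Hypothesis mF : forall k, measurable_fun setT (fun x : borel 'rV[R]_d => F x k).
Hypothesis F_base : forall x k, `|F x k - base x| <= sigma.
Hypothesis F_mean : forall x, (\int[pi]_z (F x z)%:E = (f x)%:E)%E.
Hypothesis f_diff : forall x, differentiable (f : 'rV[R]_d -> R^o) x.
Hypothesis f_smooth : exists2 L, 0 < L & lipschitz_gradient L f.
Hypothesis f_convex : strongly_convex mu f.

Let F_oracle (x : 'rV[R]_d) (z : discrete_nat R) : R := F x z.

Let F_measurable : measurable_fun [set: borel 'rV[R]_d * Z]
  (fun w => F_oracle w.1 w.2).
Proof.
pose g (w : borel 'rV[R]_d * Z) : nat := w.2.
pose Fn k (w : borel 'rV[R]_d * Z) : R := F w.1 k.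
have mg k : measurable (g @^-1` [set k]).
  rewrite (_ : _ @^-1` _ = [set: borel 'rV[R]_d] `*` [set k : Z]).
    by apply: measurableX; [exact: measurableT|exact: measurable_discrete_nat].
  by apply/seteqP; split => [[x z] /= ->|[x z] [_ /=]].
have mFn k : measurable_fun setT (Fn k).
  exact: (measurableT_comp (mF k) (@measurable_fst _ _ (borel 'rV[R]_d) Z)).
exact: measurable_fun_countable mg _ _ _ mFn.
Qed.

Let F_integrable x : pi.-integrable [set: Z] (EFin \o F_oracle x).
Proof.
apply: (@le_integrable _ _ _ pi _ _ _ (EFin \o cst (sigma + `|base x|))) => //.
- exact: measurable_to_discrete.
- move=> z _ /=; rewrite lee_fin [leRHS]ger0_norm ?addr_ge0// ?(ltW sigma0)//.
  rewrite -[F_oracle x z](subrK (base x)).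
  by apply: (le_trans (ler_normD _ _)); rewrite lerD2r F_base.
- exact: finite_measure_integrable_cst.
Qed.

Let F_expectation : (fun x => fine 'E_pi[F_oracle x]) = f.
Proof. by apply/funext => x; rewrite unlock F_mean. Qed.

(* Centering at the mean can only decrease the second moment, so the uniform
   bound on [F - base] bounds the variance. *)
Let F_variance x :
  ('E_pi[(fun z => `|F_oracle x z - f x| ^+ 2)%R] <= (sigma ^+ 2)%:E)%E.
Proof.
rewrite unlock.
pose m := f x - base x.
pose g (z : Z) : \bar R := ((sigma ^+ 2 + m ^+ 2 + 2 * m * base x)%:E +
   (- (2 * m))%:E * (F_oracle x z)%:E)%E.
apply: (@le_trans _ _ (\int[pi]_z g z)%E).
  apply: ge0_le_integral => //.
  - exact: measurable_to_discrete.
  - exact: measurable_to_discrete.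
  - move=> z _; rewrite /g -EFinM -EFinD lee_fin real_normK ?num_real//.
    have := F_base x z; rewrite -/(F_oracle x z) ler_norml => /andP[l1 l2].
    rewrite /m; set y := F_oracle x z in l1 l2 *.
    by nra.
rewrite /g integralD//; last 2 first.
- exact: finite_measure_integrable_cst.
- exact: (integrableZl measurableT _ (F_integrable x)).
rewrite (integralZl measurableT (F_integrable x)) F_mean integral_cst//.
rewrite [X in (_ * X)%E](_ : _ = 1%E); last exact: probability_setT.
rewrite mule1 -EFinM -EFinD lee_fin /m.
have := sqr_ge0 (f x - base x); nra.
Qed.

Definition instance_of_lazy_mapping : one_point_instance d tau mu sigma.
Proof.
refine (@Build_one_point_instance R d tau mu sigma (discrete_nat R)
  (@separable_discrete_nat R) (trans_kernel S upd) pi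
  (invariant_lazy p_gt0 p_le1 lazyQ) (invariant_lazy_unique p_gt0 p_le1 lazyQ)
  (mixing_lazy p_gt0 p_le1 lazyQ tau0 ptau) _ (source S) (source_prob S)
  (mapping_chain S init upd) (markov_mapping_chain S init upd)
  F_oracle F_measurable F_integrable _ _ _ _); rewrite ?F_expectation //.
by move: F_variance; rewrite -F_expectation.
Defined.

Lemma objective_instance : objective instance_of_lazy_mapping = f.
Proof. exact: F_expectation. Qed.

Lemma oracle_instance : oracle instance_of_lazy_mapping = F.
Proof. by []. Qed.

End instance_of_lazy_mapping.

(** * Testing two adapted processes *)
Section path_expectation.
Context {R : realType} {V : finType}.
Implicit Types (q : seq V -> V -> R) (G : seq V -> R).

Fixpoint path_exp q n G : R :=
  if n is n'.+1 then
    \sum_(v : V) q [::] v *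
      path_exp (fun h => q (v :: h)) n' (fun b => G (v :: b))
  else G [::].

Lemma path_exp_sum q n (I : finType) (G : I -> seq V -> R) :
  path_exp q n (fun b => \sum_i G i b) = \sum_i path_exp q n (G i).
Proof.
elim: n q G => [//|n IH] q G /=.
under eq_bigr do rewrite IH mulr_sumr.
by rewrite exchange_big.
Qed.

Fixpoint all_paths n : seq (seq V) :=
  if n is n'.+1 then [seq v :: b | v <- enum V, b <- all_paths n'] else [:: [::]].

Lemma mem_all_paths b : b \in all_paths (size b).
Proof.
elim: b => [|v b IH]; first by rewrite inE.
by apply/allpairsP; exists (v, b); rewrite mem_enum IH.
Qed.

Lemma size_all_paths n b : b \in all_paths n -> size b = n.
Proof.
elim: n b => [|n IH] b /=; first by rewrite inE => /eqP ->.
by case/allpairsP => -[v b'] [_ /= /IH <- ->].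
Qed.

Lemma uniq_all_paths n : uniq (all_paths n).
Proof.
elim: n => // n IH; apply: allpairs_uniq => //; first exact: enum_uniq.
by move=> [v b] [v' b'] _ _ [-> ->].
Qed.

Lemma path_expE q n G :
  path_exp q n G = \sum_(b <- all_paths n) path_weight q b * G b.
Proof.
elim: n q G => [|n IH] q G; first by rewrite /= big_seq1 mul1r.
rewrite /= big_allpairs_dep big_enum; apply: eq_bigr => v _.
by rewrite IH mulr_sumr; apply: eq_bigr => b _; rewrite mulrA.
Qed.

Definition kernel_law q := (forall h v, 0 <= q h v) /\ (forall h, \sum_v q h v = 1).

(** If the chi-square divergence of every step satisfies
    [\sum_v q' v ^+ 2 / q v <= c], then no test separates the two path laws well.
    On a single path the claim is [min (a, b) >= b - b^2 / (4 * a)], where the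
    bound by [a] says that [(2 * a - b)^2] is nonnegative.  The weights [a] and [b] make the induction work: after the first
    symbol they become [a * q v] and [b * q' v], and summing
    [(b * q' v)^2 / (4 * (a * q v))] over [v] produces the divergence of the
    step. *)
Lemma two_point q q' (c : nat -> R) n G G' (K a b : R) :
  kernel_law q -> kernel_law q' ->
  (forall h v, q h v = 0 -> q' h v = 0) ->
  (forall h, \sum_v q' h v ^+ 2 / q h v <= c (size h)) ->
  (forall k, 0 <= c k) ->
  (forall e, 0 <= G e) -> (forall e, 0 <= G' e) -> (forall e, K <= G e + G' e) ->
  0 <= K -> 0 <= a -> 0 <= b -> (a = 0 -> b = 0) ->
  K * (b - b ^+ 2 / (4 * a) * \prod_(k < n) c k) <=
    a * path_exp q n G + b * path_exp q' n G'.
Proof.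
move=> qk q'k qq' + + G0 G'0 GG' K0.
elim: n q q' c G G' a b qk q'k qq' G0 G'0 GG' =>
    [|n IH] q q' c G G' a b [q0 q1] [q'0 q'1] qq' G0 G'0 GG' chi c0 a0 b0 ab.
  rewrite big_ord0 mulr1 /=.
  have [a00|an0] := eqVneq a 0; first by rewrite ab// a00 expr0n !mul0r subr0 mulr0 addr0.
  have ap : 0 < a by rewrite lt_neqAle eq_sym an0.
  set m := b - b ^+ 2 / (4 * a).
  have mb : m <= b by rewrite /m lerBlDr lerDl divr_ge0 ?sqr_ge0 ?mulr_ge0.
  have ma : m <= a.
    rewrite -subr_ge0 (_ : a - m = (2 * a - b) ^+ 2 / (4 * a)); last by rewrite /m; field.
    by rewrite divr_ge0 ?sqr_ge0 ?mulr_ge0.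
  have [m0|m0] := leP 0 m; last first.
    apply: (@le_trans _ _ 0); first by rewrite mulr_ge0_le0// ltW.
    by rewrite addr_ge0// mulr_ge0.
  rewrite mulrC; apply: (le_trans (ler_wpM2l m0 (GG' [::]))).
  by rewrite mulrDr lerD// ler_wpM2r.
have stepv v : K * (b * q' [::] v - (b * q' [::] v) ^+ 2 / (4 * (a * q [::] v)) *
      \prod_(k < n) c k.+1) <=
    a * q [::] v * path_exp (fun h => q (v :: h)) n (fun e => G (v :: e)) +
    b * q' [::] v * path_exp (fun h => q' (v :: h)) n (fun e => G' (v :: e)).
  apply: (IH _ _ (fun k => c k.+1)) => //; rewrite ?mulr_ge0//; try by split.
  - by move=> h w; exact: (qq' (v :: h) w).
  - move=> /eqP; rewrite mulf_eq0 => /orP[/eqP/ab ->|/eqP/qq' ->].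
      by rewrite mul0r.
    by rewrite mulr0.
rewrite [leRHS]/= !mulr_sumr -big_split/=.
under [leRHS]eq_bigr do rewrite !mulrA.
apply: le_trans (ler_sum _ (fun v _ => stepv v)).
rewrite -mulr_sumr; apply: ler_wpM2l => //.
rewrite sumrB -mulr_sumr q'1 mulr1 lerB// big_ord_recl/=.
rewrite -mulr_suml mulrA; apply: ler_wpM2r; first by apply: prodr_ge0.
have -> : \sum_v (b * q' [::] v) ^+ 2 / (4 * (a * q [::] v)) =
    b ^+ 2 / (4 * a) * \sum_v q' [::] v ^+ 2 / q [::] v.
  rewrite mulr_sumr; apply: eq_bigr => v _.
  by rewrite exprMn !invfM; ring.
apply: ler_wpM2l; last exact: (chi [::]).
by rewrite divr_ge0 ?sqr_ge0 ?mulr_ge0.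
Qed.

End path_expectation.

Section integral_of_adapted.
Context {R : realType} {nu : nat -> R} (S : bernoulli_shift nu) {V : finType}.
Local Notation P := (source_prob S).

Lemma integral_adapted (r : seq V -> nat -> V) n (G : seq V -> R) :
  (forall b, 0 <= G b) ->
  (\int[P]_u (G (adapted r n u))%:E = (path_exp (letter_law S r) n G)%:E)%E.
Proof.
move=> G0.
have E u : (G (adapted r n u))%:E =
    (\sum_(b <- all_paths n) (G b)%:E * (\1_([set u | adapted r n u = b]) u)%:E)%E.
  have mem : adapted r n u \in all_paths n by rewrite -{2}(size_adapted r n u) mem_all_paths.
  rewrite (bigD1_seq (adapted r n u)) ?uniq_all_paths//=.
  rewrite indicE mem_set//= mule1 big1 ?adde0// => b bu.
  by rewrite indicE memNset ?mule0// => /= ub; rewrite ub eqxx in bu.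
under eq_integral do rewrite E.
rewrite ge0_integral_sum//; last 2 first.
- move=> b; apply: measurable_funeM; apply/measurable_EFinP/measurable_indic.
  exact: measurable_adapted.
- by move=> b u _; rewrite mule_ge0 ?lee_fin.
rewrite path_expE -sumEFin !big_seq; apply: eq_bigr => b /size_all_paths bn.
rewrite ge0_integralZl_EFin//; last first.
  apply/measurable_EFinP/measurable_indic; exact: measurable_adapted.
rewrite integral_indic ?setIT//; last exact: measurable_adapted.
by rewrite -bn [X in (_ * X)%E]adapted_law -EFinM mulrC.
Qed.

Lemma kernel_letter_law (r : seq V -> nat -> V) : kernel_law (letter_law S r).
Proof.
split=> [h v|h]; first by rewrite fine_ge0.
have := @integral_adapted (fun _ => r h) 1 (fun=> 1) (fun=> ler01).
rewrite integral_cst; last exact: measurableT.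
rewrite mul1e [LHS]probability_setT /= => -[] ->.
by apply: eq_bigr => v _; rewrite mulr1.
Qed.

End integral_of_adapted.

(** Each direction of the cube pairs opposite vertices, whose targets differ by
    [2 * t] in that coordinate.  The two squared errors of an estimate add up to
    at least [2 * t^2], and [two_point] preserves half of this. *)
Section assouad.
Context {R : realType} {V : finType} {d : nat}.
Local Notation cube := {ffun 'I_d -> bool}.

Definition flip (i : 'I_d) (w : cube) : cube :=
  [ffun j => if j == i then ~~ w j else w j].

Lemma flipK i : involutive (flip i).
Proof.
by move=> w; apply/ffunP => j; rewrite !ffunE; case: eqP => // _; rewrite negbK.
Qed.

Lemma flip_at i w : flip i w i = ~~ w i.
Proof. by rewrite ffunE eqxx. Qed.

Lemma flip_off i w j : j != i -> flip i w j = w j.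
Proof. by move=> ji; rewrite ffunE (negbTE ji). Qed.

Variables (q : cube -> seq V -> V -> R) (c : nat -> R) (n : nat).
Variables (est : seq V -> 'rV[R]_d) (t : R).
Hypothesis lawq : forall w, kernel_law (q w).
Hypothesis suppq : forall w i h v, q w h v = 0 -> q (flip i w) h v = 0.
Hypothesis chiq : forall w i h,
  \sum_v q (flip i w) h v ^+ 2 / q w h v <= c (size h).
Hypothesis c0 : forall k, 0 <= c k.
Hypothesis prodc : \prod_(k < n) c k <= 2.

Lemma assouad :
  2 ^+ d * (d%:R * t ^+ 2 / 2) <=
  \sum_w path_exp (q w) n
    (fun b => enorm (est b - \row_i (- signr (w i) * t)) ^+ 2).
Proof.
pose G (w : cube) i b := (est b ord0 i + signr (w i) * t) ^+ 2.
have -> : \sum_w path_exp (q w) n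
    (fun b => enorm (est b - \row_i (- signr (w i) * t)) ^+ 2) =
    \sum_i \sum_w path_exp (q w) n (G w i).
  rewrite exchange_big; apply: eq_bigr => w _; rewrite -path_exp_sum.
  congr path_exp; apply/funext => b; rewrite enorm_sqr; apply: eq_bigr => i _.
  by rewrite !mxE mulNr opprK.
have -> : 2 ^+ d * (d%:R * t ^+ 2 / 2) = \sum_(i < d) (2 ^+ d * (t ^+ 2 / 2)) :> R.
  by rewrite sumr_const card_ord -[RHS]mulr_natl; ring.
apply: ler_sum => i _.
have pair w : t ^+ 2 <= path_exp (q w) n (G w i) + path_exp (q (flip i w)) n (G (flip i w) i).
  have := @two_point _ _ (q w) (q (flip i w)) c n (G w i) (G (flip i w) i) (2 * t ^+ 2) 1 1
    (lawq w) (lawq _) (@suppq w i) (@chiq w i) c0.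
  rewrite !mul1r !mulr1 expr1n => /(_ _ _ _ _ ler01 ler01) h.
  have {h} : 2 * t ^+ 2 * (1 - 4^-1 * \prod_(k < n) c k) <=
      path_exp (q w) n (G w i) + path_exp (q (flip i w)) n (G (flip i w) i).
    rewrite -div1r; apply: h.
    - by move=> b; exact: sqr_ge0.
    - by move=> b; exact: sqr_ge0.
    - move=> b; rewrite /G flip_at -subr_ge0.
      have := sqr_ge0 (est b ord0 i).
      by case: (w i); rewrite /signr /=; nra.
    - by rewrite mulr_ge0 ?sqr_ge0.
    - by move=> /eqP; rewrite oner_eq0.
  apply: le_trans.
  have := sqr_ge0 t; move: prodc (t ^+ 2); move: (\prod_(k < n) _) => x x2 y y0.
  by nra.
have flip_sum : \sum_w path_exp (q w) n (G w i) =
    \sum_w path_exp (q (flip i w)) n (G (flip i w) i).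
  by rewrite (reindex_inj (inv_inj (flipK i))).
suff : 2 ^+ d * t ^+ 2 <= 2 * \sum_w path_exp (q w) n (G w i) by lra.
rewrite [leRHS](_ : _ = \sum_w path_exp (q w) n (G w i) +
  \sum_w path_exp (q (flip i w)) n (G (flip i w) i)); last by rewrite -flip_sum; ring.
rewrite -big_split/=.
apply: le_trans (ler_sum _ (fun w _ => pair w)).
by rewrite sumr_const card_ffun card_bool card_ord -(mulr_natr (t ^+ 2) (2 ^ d)) natrX mulrC.
Qed.

End assouad.

(** * Averaging over instances and internal randomness *)
Section borel_row_vectors.
Context {R : realType} {d : nat}.

Lemma continuous_borel_measurable (T : ptopologicalType) (f : T -> R) :
  continuous f -> measurable_fun [set: borel T] (f : borel T -> R).
Proof.
move=> /continuousP cf mT; apply: (measurability _ (RGenOpens.measurableE R)); last exact: mT.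
move=> _ [_ [a [b ->] <-]]; rewrite setTI.
by apply: sub_sigma_algebra; exact/cf/interval_open.
Qed.

Lemma measurable_coord (i : 'I_d) :
  measurable_fun setT (fun x : borel 'rV[R]_d => x ord0 i : R).
Proof.
apply: (@continuous_borel_measurable 'rV[R]_d (fun x => x ord0 i)).
exact: coord_continuous.
Qed.

Lemma measurable_enorm_sqr (c : 'rV[R]_d) :
  measurable_fun setT (fun x : borel 'rV[R]_d => enorm ((x : 'rV[R]_d) - c) ^+ 2).
Proof.
rewrite (_ : (fun _ => _) = (fun x : borel 'rV[R]_d =>
    \sum_(i < d) ((x : 'rV[R]_d) ord0 i - c ord0 i) ^+ 2)).
  apply: measurable_sum => i; apply: measurable_funX.
  by apply: measurable_funB => //; exact: measurable_coord.
apply/funext => x; rewrite enorm_sqr; apply: eq_bigr => i _.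
by rewrite !mxE.
Qed.

End borel_row_vectors.

Section averaging_over_instances.
Context {R : realType} {d tau N : nat} {mu sigma : R}.
Variable a : one_point_algorithm R d N.
Implicit Type I : one_point_instance d tau mu sigma.

Definition sqr_error I (s : seed_space a) (u : chain_space I) : R :=
  enorm (output a (s, observations (oracle I) s (fun i => chain I i u) N)
         - minimizer (objective I)) ^+ 2.

Lemma measurable_observations I k :
  measurable_fun setT (fun w : seed_space a * chain_space I =>
    observations (oracle I) w.1 (fun i => chain I i w.2) k).
Proof.
elim: k => [|k IH]; first exact: measurable_cst.
have mquery : measurable_fun setT (fun w : seed_space a * chain_space I =>
    query a k (w.1, observations (oracle I) w.1 (fun i => chain I i w.2) k) :
    borel 'rV[R]_d).
  apply: (measurableT_comp (@query_measurable _ _ _ a k)).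
  by apply: measurable_fun_pair => //; exact: measurable_fst.
have mF : measurable_fun setT (fun w : seed_space a * chain_space I =>
   oracle I (query a k (w.1, observations (oracle I) w.1 (fun i => chain I i w.2) k))
     (chain I k w.2)).
  apply: (measurableT_comp (oracle_measurable (o := I))
    (g := fun w => (query a k (w.1, observations (oracle I) w.1
       (fun i => chain I i w.2) k) : borel 'rV[R]_d, chain I k w.2))).
  apply: measurable_fun_pair => //.
  exact: (measurableT_comp (measurable_funPT (chain I k)) measurable_snd).
apply/measurable_fun_tnthP => i.
have [ik|ki] := ltnP i k.
  rewrite (_ : _ \o _ = (fun w => tnth
    (observations (oracle I) w.1 (fun i => chain I i w.2) k) (Ordinal ik))).
    by have /measurable_fun_tnthP := IH => /(_ (Ordinal ik)).
  apply/funext => w /=; rewrite !(tnth_nth 0) /= nth_rcons size_tuple.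
  by rewrite ik.
move: mF; congr measurable_fun; apply/funext => w /=.
rewrite (tnth_nth 0) /= nth_rcons size_tuple ltnNge ki /=.
have -> : (i : nat) == k by rewrite eqn_leq ki andbT -ltnS ltn_ord.
by [].
Qed.

Lemma measurable_sqr_error I : measurable_fun setT
  (fun w : seed_space a * chain_space I => sqr_error w.1 w.2).
Proof.
apply: (measurableT_comp (measurable_enorm_sqr (minimizer (objective I)))).
apply: (measurableT_comp (@output_measurable _ _ _ a)).
by apply: measurable_fun_pair; [exact: measurable_fst|exact: measurable_observations].
Qed.

Definition seed_error I (s : seed_space a) : \bar R :=
  (\int[chain_prob I]_u (sqr_error s u)%:E)%E.

Lemma mean_squared_errorE I :
  mean_squared_error a I = (\int[seed_prob a]_s seed_error I s)%E.
Proof.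
apply: (fubini_tonelli1 (fun w => (sqr_error w.1 w.2)%:E)).
  by apply/measurable_EFinP; exact: measurable_sqr_error.
by move=> w; rewrite lee_fin sqr_ge0.
Qed.

Lemma measurable_seed_error I : measurable_fun setT (seed_error I).
Proof.
apply: (measurable_fun_fubini_tonelli_F (fun w => (sqr_error w.1 w.2)%:E)).
  by apply/measurable_EFinP; exact: measurable_sqr_error.
by move=> w; rewrite lee_fin sqr_ge0.
Qed.

(** The largest error of a finite family is at least its average, and Tonelli's
    theorem turns the average error into an integral over the internal randomness,
    so that it suffices to treat deterministic algorithms. *)
Lemma hard_instance_exists (Omega : finType)
    (I : Omega -> one_point_instance d tau mu sigma) (B : R) :
  (0 < #|Omega|)%N ->
  (forall s, (#|Omega|%:R * B)%:E <= \sum_w seed_error (I w) s)%E ->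
  exists w, (B%:E <= mean_squared_error a (I w))%E.
Proof.
move=> Omega0 low; apply/not_existsP => small.
have {}small w : (mean_squared_error a (I w) < B%:E)%E.
  by rewrite ltNge; apply/negP/small.
have : ((#|Omega|%:R * B)%:E <= \sum_w mean_squared_error a (I w))%E.
  under eq_bigr do rewrite mean_squared_errorE.
  rewrite -ge0_integral_sum//; last 2 first.
  - by move=> w; exact: measurable_seed_error.
  - by move=> w s _; apply: integral_ge0 => u _; rewrite lee_fin sqr_ge0.
  have -> : (#|Omega|%:R * B)%:E = (\int[seed_prob a]_s (cst (#|Omega|%:R * B)%:E) s)%E.
    rewrite integral_cst; last exact: measurableT.
    by rewrite [X in (_ * X)%E](_ : _ = 1%E) ?mule1//; exact: probability_setT.
  have [B0|B0] := leP 0 B; last first.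
    apply: (@le_trans _ _ 0%E).
      rewrite integral_cst; last exact: measurableT.
      rewrite [X in (_ * X)%E](_ : _ = 1%E); last exact: probability_setT.
      by rewrite mule1 lee_fin mulr_ge0_le0// ltW.
    apply: integral_ge0 => s _; apply: sume_ge0 => w _.
    by apply: integral_ge0 => u _; rewrite lee_fin sqr_ge0.
  apply: ge0_le_integral => //.
  - by move=> s _; rewrite lee_fin mulr_ge0.
  - apply: emeasurable_sum => w; exact: measurable_seed_error.
have finw w : mean_squared_error a (I w) = (fine (mean_squared_error a (I w)))%:E.
  rewrite fineK// ge0_fin_numE ?(lt_trans (small w)) ?ltry//.
  by apply: integral_ge0 => u _; rewrite lee_fin sqr_ge0.
under eq_bigr do rewrite finw.
rewrite sumEFin lee_fin leNgt => /negP; apply.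
rewrite mulr_natl -[#|Omega|]/(#|xpredT : pred Omega|) -sumr_const.
have [w0 _] := card_gt0P Omega0.
rewrite (bigD1 w0)//= [ltRHS](bigD1 w0)//=.
have ltw w : fine (mean_squared_error a (I w)) < B by rewrite -lte_fin -finw.
by apply: ltr_leD => //; apply: ler_sum => w _; exact: ltW.
Qed.

End averaging_over_instances.

(** * Laws of finitely many values *)
Section finite_valued.
Context {dT : measure_display} {T : measurableType dT} {R : realType}.
Context {V : finType} (m : probability T R) (r : T -> V).
Hypothesis mr : forall v, measurable [set x | r x = v].

Definition value_prob (v : V) : R := fine (m [set x | r x = v]).

Lemma value_probE v : m [set x | r x = v] = (value_prob v)%:E.
Proof. by rewrite /value_prob fineK//; exact: fin_num_measure. Qed.

Lemma integral_finite_valued (G : V -> R) :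
  (\int[m]_x (G (r x))%:E = (\sum_v value_prob v * G v)%:E)%E.
Proof.
have E x : (G (r x))%:E =
    (\sum_v (G v)%:E * (\1_([set x | r x = v]) x)%:E)%E.
  rewrite (bigD1 (r x))//= indicE mem_set//= mule1 big1 ?adde0// => v rv.
  by rewrite indicE memNset ?mule0// => /= rxv; rewrite rxv eqxx in rv.
under eq_integral do rewrite E.
rewrite integral_sum//; last first.
  by move=> v; apply: integrableZl => //; exact: integrable_indic.
rewrite -sumEFin; apply: eq_bigr => v _.
rewrite integralZl//; last exact: integrable_indic.
rewrite integral_indic ?setIT//.
by rewrite [X in (_ * X)%E]value_probE -EFinM mulrC.
Qed.

Lemma sum_value_prob : \sum_v value_prob v = 1.
Proof.
have := integral_finite_valued (fun=> 1).
rewrite integral_cst; last exact: measurableT.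
rewrite [X in (_ * X)%E](_ : _ = 1%E); last exact: probability_setT.
by rewrite mule1 => -[->]; apply: eq_bigr => v _; rewrite mulr1.
Qed.

Lemma prob_value_in (C : pred V) :
  m [set x | C (r x)] = (\sum_v value_prob v * (C v)%:R)%:E.
Proof.
rewrite -integral_finite_valued.
have -> : [set x | C (r x)] = \big[setU/set0]_(v | C v) [set x | r x = v].
  rewrite -bigcup_seq_cond; apply/seteqP; split => [x /= Cx|x [v /= /andP[_ Cv] ->//]].
  by exists (r x) => //=; rewrite mem_index_enum.
rewrite -[in LHS](setIT (\big[_/_]_(_ | _) _)) -integral_indic//; last first.
  by apply: bigsetU_measurable => v _.
apply: eq_integral => x _; congr _%:E; rewrite indicE; congr (nat_of_bool _)%:R.
rewrite -bigcup_seq_cond; apply/idP/idP => [/set_mem[v /= /andP[_ Cv] ->//]|Cx].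
by apply/mem_set; exists (r x) => //=; rewrite mem_index_enum.
Qed.

End finite_valued.

(** By induction, the product times [1 - \sum_k e k] stays at most [1]. *)
Lemma prod_le2 (R : realType) (e : nat -> R) n :
  (forall k, 0 <= e k) -> \sum_(k < n) e k <= 2^-1 ->
  \prod_(k < n) (1 + e k) <= 2.
Proof.
move=> e0 en.
have S0 m : 0 <= \sum_(k < m) e k by apply: sumr_ge0 => k _.
have P0 m : 0 <= \prod_(k < m) (1 + e k) by apply: prodr_ge0 => k _; rewrite addr_ge0.
have : \prod_(k < n) (1 + e k) * (1 - \sum_(k < n) e k) <= 1.
  elim: n {en} => [|n IH]; first by rewrite !big_ord0 subr0 mulr1.
  rewrite !big_ord_recr/=; apply: le_trans IH.
  move: (S0 n) (P0 n) (e0 n); move: (\sum_(_ < _) _) (\prod_(_ < _) _) (e n).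
  move=> s p x s0 p0 x0; rewrite -mulrA; apply: ler_wpM2l => //.
  have := mulr_ge0 x0 s0; have := sqr_ge0 x; rewrite expr2; lra.
move: en (P0 n); move: (\sum_(_ < _) _) (\prod_(_ < _) _) => s p s2 p0; nra.
Qed.

Section finite_source.
Context {R : realType} {A : finType} (a0 : A) (w : A -> R).
Hypotheses (w0 : forall a, 0 <= w a) (w1 : \sum_a w a = 1).

Definition finite_pmf (n : nat) : R :=
  if (n < #|A|)%N then w (nth a0 (enum A) n) else 0.

Let pmf0 n : 0 <= finite_pmf n.
Proof. by rewrite /finite_pmf; case: ifP. Qed.

Let pmf_total k : cumul finite_pmf (#|A| + k) = 1.
Proof.
elim: k => [|k IH]; last first.
  rewrite addnS /cumul big_ord_recr/= -/(cumul _ _) IH /finite_pmf ifN ?addr0//.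
  by rewrite -leqNgt leq_addr.
rewrite addn0 -w1 /cumul -(big_mkord xpredT finite_pmf) -[RHS]big_enum/=.
rewrite (big_nth a0) -cardE; apply: eq_big_nat => i /andP[_ iA].
by rewrite /finite_pmf iA.
Qed.

Let pmf_le1 n : cumul finite_pmf n <= 1.
Proof.
rewrite -(pmf_total n) addnC /cumul -!(big_mkord xpredT finite_pmf).
by rewrite (@big_cat_nat _ _ _ n 0 (n + #|A|))//= ?leq_addr// lerDl sumr_ge0.
Qed.

Let pmf_sup e : 0 < e -> exists n, 1 - e < cumul finite_pmf n.
Proof.
by move=> e0; exists #|A|; have := pmf_total 0; rewrite addn0 => ->; rewrite ltrBlDr ltrDl.
Qed.

Definition finite_source : bernoulli_shift finite_pmf :=
  lebesgue_source pmf0 pmf_le1 pmf_sup.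

Definition symbol (l : nat) : A := nth a0 (enum A) l.

Lemma measurable_symbol a :
  measurable [set u : source finite_source | symbol (letter u) = a].
Proof. exact: (measurable_letter_in finite_source [set l | symbol l = a]). Qed.

(** Letters beyond [#|A|] carry no mass, so the default value of [nth] changes no
    probability: each symbol has at least its weight, and the weights sum to [1]. *)
Lemma symbol_law a :
  value_prob (source_prob finite_source) (fun u => symbol (letter u)) a = w a.
Proof.
set m := source_prob finite_source; set v := value_prob m _.
have le b : w b <= v b.
  rewrite -lee_fin -value_probE; last exact: measurable_symbol.
  have ib : (index b (enum A) < #|A|)%N by rewrite cardE index_mem mem_enum.
  have -> : w b = finite_pmf (index b (enum A)).
    by rewrite /finite_pmf ib nth_index ?mem_enum.
  rewrite -(prob_letter finite_source); apply: le_measure; rewrite ?inE.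
  - exact: measurable_letter.
  - exact: measurable_symbol.
  - by move=> u /= ->; rewrite /symbol nth_index// mem_enum.
have : \sum_b (v b - w b) = 0.
  by rewrite sumrB w1 sum_value_prob ?subrr//; exact: measurable_symbol.
move=> /eqP; rewrite psumr_eq0 => [/allP/(_ a)|b _]; last by rewrite subr_ge0.
by rewrite mem_index_enum subr_eq0 => /(_ isT)/eqP.
Qed.

End finite_source.

(** * Observations as functions of an adapted process *)
Section observations_of_adapted.
Context {R : realType} {d N : nat} (a : one_point_algorithm R d N).
Context {nu : nat -> R} (S : bernoulli_shift nu) {V : Type} (v0 : V).
Local Notation xi := (@letter _ _ S).
Local Notation T := (@shift_source _ _ S).

Lemma nth_adapted (r : seq V -> nat -> V) n k u : (k < n)%N ->
  nth v0 (adapted r n u) k = r (adapted r k u) (xi (iter k T u)).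
Proof.
elim: n => // n IH; rewrite ltnS leq_eqVlt adapted_rcons nth_rcons size_adapted.
by move=> /orP[/eqP ->|kn]; rewrite ?ltnn ?eqxx// kn IH.
Qed.

Lemma eq_observations (Z Z' : Type) (F : 'rV[R]_d -> Z -> R) (F' : 'rV[R]_d -> Z' -> R)
    (s : seed_space a) (z : nat -> Z) (z' : nat -> Z') n :
  (forall k, (k < n)%N ->
    let x := query a k (s, observations F' s z' k) in F x (z k) = F' x (z' k)) ->
  observations F s z n = observations F' s z' n.
Proof.
elim: n => // n IH FF /=; rewrite IH => [|k kn]; last exact/FF/ltnW.
by rewrite FF.
Qed.

Definition next_query (F' : 'rV[R]_d -> V -> R) (s : seed_space a) (h : seq V) :
    'rV[R]_d :=
  query a (size h) (s, observations F' s (nth v0 h) (size h)).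

(** The query points depend on the past symbols only, hence the whole transcript
    can be replayed from the symbols through an oracle [F'] that does not know
    the hidden signs. *)
Lemma observations_adapted (F' : 'rV[R]_d -> V -> R) (r : seq V -> nat -> V)
    (Z : Type) (F : 'rV[R]_d -> Z -> R) (s : seed_space a) (z : nat -> Z) u n :
  (forall k, (k < n)%N -> let h := adapted r k u in
    F (next_query F' s h) (z k) =
    F' (next_query F' s h) (r h (xi (iter k T u)))) ->
  observations F s z n = observations F' s (nth v0 (adapted r n u)) n.
Proof.
move=> FF; apply: eq_observations => k kn.
have -> : observations F' s (nth v0 (adapted r n u)) k =
    observations F' s (nth v0 (adapted r k u)) k.
  apply: eq_observations => j jk /=.
  by rewrite !nth_adapted// (ltn_trans jk).
have := FF k kn; rewrite /next_query size_adapted /= => ->.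
by rewrite nth_adapted.
Qed.

End observations_of_adapted.

Section seedwise.
Context {R : realType} {d : nat} {V : finType}.
Local Notation cube := {ffun 'I_d -> bool}.
Variables (nu : cube -> nat -> R) (S : forall w, bernoulli_shift (nu w)).
Variables (r : cube -> seq V -> nat -> V) (est : seq V -> 'rV[R]_d).
Variables (eta : nat -> R) (n : nat) (t : R).
Local Notation q w := (letter_law (S w) (r w)).
Hypothesis suppq : forall w i h v, q w h v = 0 -> q (flip i w) h v = 0.
Hypothesis chiq : forall w i h,
  \sum_v q (flip i w) h v ^+ 2 / q w h v <= 1 + eta (size h).
Hypothesis eta0 : forall k, 0 <= eta k.
Hypothesis eta_sum : \sum_(k < n) eta k <= 2^-1.

(** The hypothesis on [eta] says that the total information about each single sign
    stays bounded: the chi-square divergences multiply to at most [2]. *)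
Lemma seedwise_bound :
  ((#|{: cube}|%:R * (d%:R * t ^+ 2 / 2))%:E <=
   \sum_w \int[source_prob (S w)]_u
     (enorm (est (adapted (r w) n u) - \row_i (- signr (w i) * t)) ^+ 2)%:E)%E.
Proof.
rewrite card_ffun card_bool card_ord natrX.
under eq_bigr => w _ do rewrite (integral_adapted (S w) (r w) n
  (G := fun b => enorm (est b - \row_i (- signr (w i) * t)) ^+ 2)
  (fun b => sqr_ge0 _)).
rewrite sumEFin lee_fin.
apply: (@assouad _ _ _ (fun w => q w) (fun k => 1 + eta k)) => //.
- by move=> w; exact: kernel_letter_law.
- by move=> k; rewrite addr_ge0.
- exact: prod_le2.
Qed.

End seedwise.

(** * Slowly mixing chains: noise carried by random directions *)
Section measurability_of_the_objective.
Context {R : realType} {d : nat}.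
Variables (beta theta : R) (w : {ffun 'I_d -> bool}).

Lemma measurable_ripple : measurable_fun setT (@ripple R).
Proof.
apply: continuous_measurable_fun => t; apply: cvgM; first exact: cvg_id.
apply: cvgV; first by rewrite gt_eqF// onesq_gt0.
by apply: cvgD; [exact: cvg_cst|exact: exprn_continuous].
Qed.

Lemma measurable_ripple_coord i :
  measurable_fun setT (fun x : borel 'rV[R]_d => ripple (x ord0 i / theta)).
Proof.
apply: (measurableT_comp measurable_ripple).
by apply: measurable_funM => //; exact: measurable_coord.
Qed.

Lemma measurable_hard_base :
  measurable_fun setT (hard_base beta theta : borel 'rV[R]_d -> R).
Proof.
apply: measurable_sum => i; apply: measurable_funM => //.
apply: measurable_funM => //; apply: measurable_funX.
by apply: measurable_funM => //; exact: measurable_coord.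
Qed.

Lemma measurable_signal :
  measurable_fun setT (signal theta w : borel 'rV[R]_d -> R).
Proof.
apply: measurable_sum => i; apply: measurable_funM => //.
exact: measurable_ripple_coord.
Qed.

End measurability_of_the_objective.

(** The state is a direction with a sign; letters carry in addition the flag that
    decides between redrawing and keeping the state. *)
Section block_regime.
Context {R : realType} {d tau N : nat} {mu sigma : R}.
Variable a : one_point_algorithm R d N.
Variables (delta theta p : R) (j0 : 'I_d).
Hypotheses (tau0 : (0 < tau)%N) (mu0 : 0 < mu) (sigma0 : 0 < sigma).
Hypotheses (delta0 : 0 < delta) (delta_half : delta <= 2^-1).
Hypotheses (p_gt0 : 0 < p) (p_le1 : p <= 1) (ptau : (1 - p) ^+ tau <= 4^-1).
Local Notation beta := (sigma * delta / d%:R).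
Hypotheses (theta0 : 0 < theta) (theta2 : mu * theta ^+ 2 = beta).
Local Notation chi0 := (16 / 3 * delta ^+ 2 / d%:R).
Hypothesis budget : chi0 * (1 + p * N%:R) <= 2^-1.
Local Notation cube := {ffun 'I_d -> bool}.
Local Notation state := ('I_d * bool)%type.
Local Notation alphabet := (bool * state)%type.
Implicit Types (w : cube) (v : state).

(* Only a default value: the direction [j0] exists because [d] is positive. *)
Let v0 : state := (j0, true).
Let a0 : alphabet := (true, v0).

Let d_gt0 : 0 < d%:R :> R.
Proof. by rewrite ltr0n (leq_ltn_trans _ (ltn_ord j0)). Qed.

Let d_neq0 : d%:R != 0 :> R.
Proof. by rewrite gt_eqF. Qed.

Definition state_weight w v : R :=
  (1 + signr v.2 * signr (w v.1) * delta) / (2 * d%:R).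

Let tilt w v : `|signr v.2 * signr (w v.1) * delta| <= 2^-1.
Proof. by rewrite !normrM !normr_signr !mul1r gtr0_norm. Qed.

Lemma state_weight_gt0 w v : 0 < state_weight w v.
Proof.
rewrite /state_weight divr_gt0 ?mulr_gt0//.
by have := tilt w v; rewrite ler_norml => /andP[]; lra.
Qed.

Lemma sum_state (G : state -> R) :
  \sum_v G v = \sum_(j < d) (G (j, true) + G (j, false)).
Proof.
rewrite (eq_bigr (fun v => G (v.1, v.2))) => [|[]//].
rewrite -(pair_bigA _ (fun j b => G (j, b)))/=.
by apply: eq_bigr => j _; rewrite big_bool.
Qed.

Lemma sum_state_weight w : \sum_v state_weight w v = 1.
Proof.
rewrite sum_state (eq_bigr (fun=> d%:R^-1)) => [|j _].
  by rewrite sumr_const card_ord -[LHS]mulr_natl mulfV.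
by rewrite /state_weight /signr /=; field.
Qed.

Definition letter_weight w (l : alphabet) : R :=
  (if l.1 then p else 1 - p) * state_weight w l.2.

Let letter_weight_ge0 w l : 0 <= letter_weight w l.
Proof.
rewrite mulr_ge0 ?(ltW (state_weight_gt0 _ _))//.
by case: ifP => _; rewrite ?subr_ge0// ltW.
Qed.

Lemma sum_letter (G : alphabet -> R) :
  \sum_l G l = \sum_v G (true, v) + \sum_v G (false, v).
Proof.
rewrite (eq_bigr (fun l => G (l.1, l.2))) => [|[]//].
by rewrite -(pair_bigA _ (fun f v => G (f, v)))/= big_bool.
Qed.

Let sum_letter_weight w : \sum_l letter_weight w l = 1.
Proof.
by rewrite sum_letter -!mulr_sumr sum_state_weight /=; ring.
Qed.

Definition block_source w : bernoulli_shift (finite_pmf a0 (letter_weight w)) :=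
  finite_source a0 (letter_weight_ge0 w) (sum_letter_weight w).

Local Notation sym := (symbol a0).

Definition decode (z : nat) : state := odflt v0 (unpickle z).

Let decodeK v : decode (pickle v) = v.
Proof. by rewrite /decode pickleK. Qed.

Definition block_init (l : nat) : nat := pickle (sym l).2.
Definition block_upd (z l : nat) : nat := if (sym l).1 then pickle (sym l).2 else z.

Let prob_letters w (C : pred alphabet) :
  source_prob (block_source w) [set u | C (sym (letter u))] =
  (p * (\sum_v state_weight w v * (C (true, v))%:R) +
   (1 - p) * (\sum_v state_weight w v * (C (false, v))%:R))%:E.
Proof.
rewrite (prob_value_in _ (measurable_symbol _ _ _)); congr _%:E.
rewrite sum_letter !mulr_sumr.
by congr (_ + _); apply: eq_bigr => v _; rewrite symbol_law mulrA.
Qed.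

Lemma block_lazy w : lazy_mapping (block_source w) block_init block_upd p.
Proof.
move=> z A.
pose C1 (l : alphabet) := `[< A (pickle l.2 : discrete_nat R) >].
pose C2 (l : alphabet) := `[< A (if l.1 then pickle l.2 else z : discrete_nat R) >].
have -> : init_law (block_source w) block_init A =
    (\sum_v state_weight w v * (C1 (true, v))%:R)%:E.
  rewrite init_lawE (_ : _ @^-1` _ = [set u | C1 (sym (letter u))]).
    by rewrite prob_letters -mulrDl addrC subrK mul1r.
  by apply/seteqP; split => u /asboolP.
rewrite trans_kernelE (_ : _ @^-1` _ = [set u | C2 (sym (letter u))]); last first.
  by apply/seteqP; split => u /asboolP.
rewrite prob_letters diracE -!EFinM -EFinD addrC; congr (_ + _)%:E.
rewrite (eq_bigr (fun v => state_weight w v * (`[< A z >])%:R)) => [|//].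
by rewrite -mulr_suml sum_state_weight mul1r.
Qed.

Definition block_value (x : 'rV[R]_d) v : R :=
  hard_base beta theta x + sigma * (signr v.2 * ripple (x ord0 v.1 / theta)).

Definition block_oracle (x : 'rV[R]_d) (z : nat) : R := block_value x (decode z).

Let measurable_block_oracle z :
  measurable_fun setT (fun x : borel 'rV[R]_d => block_oracle x z).
Proof.
apply: measurable_funD; first exact: measurable_hard_base.
apply: measurable_funM => //; apply: measurable_funM => //.
exact: measurable_ripple_coord.
Qed.

Let block_oracle_base x z : `|block_oracle x z - hard_base beta theta x| <= sigma.
Proof.
rewrite /block_oracle /block_value addrAC subrr add0r normrM [X in _ * X]normrM normr_signr mul1r.
rewrite (gtr0_norm sigma0); apply: ler_piMr; first exact: ltW.
exact: normr_ripple_le1.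
Qed.

Let block_oracle_mean w x :
  (\int[init_law (block_source w) block_init]_z (block_oracle x z)%:E =
   (hard_obj beta theta w x)%:E)%E.
Proof.
have md v : measurable [set z : borel (discrete_nat R) | decode z = v].
  exact: measurable_discrete_nat.
rewrite (integral_finite_valued _ md (block_value x)); congr _%:E.
have vE v : value_prob (init_law (block_source w) block_init) decode v = state_weight w v.
  rewrite /value_prob init_lawE.
  pose C (l : alphabet) := l.2 == v.
  rewrite (_ : _ @^-1` _ = [set u | C (sym (letter u))]); last first.
    by apply/seteqP; split => u /=; rewrite /block_init /C decodeK => /eqP.
  rewrite prob_letters /= -mulrDl addrC subrK mul1r (bigD1 v)//= /C /= eqxx mulr1.
  by rewrite big1 ?addr0// => v' /negbTE ->; rewrite mulr0.
under eq_bigr do rewrite vE.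
have split_base : hard_base beta theta x = \sum_(j < d)
    (state_weight w (j, true) + state_weight w (j, false)) * hard_base beta theta x.
  rewrite -mulr_suml -(sum_state (fun v => state_weight w v)).
  by rewrite sum_state_weight mul1r.
rewrite sum_state /hard_obj /signal mulr_sumr [X in _ = X + _]split_base -big_split/=.
apply: eq_bigr => j _; rewrite /state_weight /block_value /=.
by move: (hard_base _ _ _) (ripple _) (signr (w j)) => B b s; rewrite /signr; field.
Qed.

Let beta0 : 0 < beta.
Proof. by rewrite divr_gt0 ?mulr_gt0. Qed.

Definition block_instance w : one_point_instance d tau mu sigma :=
  instance_of_lazy_mapping tau0 sigma0 p_gt0 p_le1 ptau (block_lazy w)
    measurable_block_oracle block_oracle_base (block_oracle_mean w)
    (hard_differentiable w mu0 beta0 theta0 theta2)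
    (ex_intro2 _ _ (8 * mu) (mulr_gt0 (ltr0Sn _ 7) mu0)
       (hard_lipschitz w mu0 beta0 theta0 theta2))
    (hard_strongly_convex w mu0 beta0 theta0 theta2).

(** The symbols of the adapted process are the successive states. *)
Definition block_visible (h : seq state) (l : nat) : state :=
  if (sym l).1 || (h == [::]) then (sym l).2 else last v0 h.

Let block_chainE w k u :
  chain (block_instance w) k u =
  pickle (block_visible (adapted (S := block_source w) block_visible k u)
     (letter (iter k (@shift_source _ _ (block_source w)) u))).
Proof.
rewrite -[LHS]/(mapping_chain (block_source w) block_init block_upd k u).
elim: k => [|k IH]; first by rewrite /block_visible orbT.
rewrite mapping_chainS IH adapted_rcons; set h := adapted _ _ _; set v := block_visible h _.
rewrite /block_upd [in RHS]/block_visible last_rcons.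
have -> : (rcons h v == [::]) = false by rewrite -size_eq0 size_rcons.
by rewrite orbF; case: (sym _).1.
Qed.

Let block_law w h v : letter_law (block_source w) block_visible h v =
  if h == [::] then state_weight w v
  else p * state_weight w v + (1 - p) * (v == last v0 h)%:R.
Proof.
rewrite /letter_law.
pose C (l : alphabet) := (if l.1 || (h == [::]) then l.2 else last v0 h) == v.
rewrite (_ : mkset _ = [set u | C (sym (letter u))]); last first.
  by apply/seteqP; split => u /=; rewrite /block_visible /C => /eqP.
rewrite prob_letters /= /C /=.
have single : \sum_v' state_weight w v' * (v' == v)%:R = state_weight w v.
  rewrite (bigD1 v)//= eqxx mulr1 big1 ?addr0// => v' /negbTE ->.
  by rewrite mulr0.
rewrite single; case: eqP => _; first by rewrite single -mulrDl addrC subrK mul1r.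
by rewrite -mulr_suml sum_state_weight mul1r eq_sym.
Qed.

Let block_law_gt0 w h v : 0 < letter_law (block_source w) block_visible h v.
Proof.
rewrite block_law; case: ifP => _; first exact: state_weight_gt0.
apply: ltr_wpDr; first by rewrite mulr_ge0 ?subr_ge0.
by rewrite mulr_gt0 ?state_weight_gt0.
Qed.

(* Only the two states in direction [i] change their weight, and together these
   have mass [1 / d]. *)
Let state_chi w i :
  \sum_v state_weight (flip i w) v ^+ 2 / state_weight w v <= 1 + chi0.
Proof.
have delta2 : delta ^+ 2 <= 4^-1.
  have -> : 4^-1 = 2^-1 ^+ 2 :> R by field.
  by rewrite ler_sqr ?nnegrE ?invr_ge0// ltW.
have pos1 : 0 < 1 + delta by rewrite addr_gt0.
have pos2 : 0 < 1 - delta.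
  by rewrite subr_gt0 (le_lt_trans delta_half)// invf_lt1// ltr1n.
have d1 : 1 + delta != 0 by rewrite gt_eqF.
have d2 : 1 - delta != 0 by rewrite gt_eqF.
rewrite sum_state (bigD1 i)//=.
rewrite (eq_bigr (fun=> d%:R^-1)) => [|j ji]; last first.
  rewrite /state_weight /= flip_off// /signr.
  by case: (w j); field; rewrite ?d_neq0 ?mulN1r ?mul1r ?opprK ?mulrN1 ?d1 ?d2.
rewrite sumr_const cardC1 card_ord.
have -> : d%:R^-1 *+ d.-1 = 1 - d%:R^-1 :> R.
  rewrite -[LHS]mulr_natl -subn1 natrB ?(leq_ltn_trans _ (ltn_ord j0))//.
  by rewrite mulrBl mulfV// mul1r.
have -> : state_weight (flip i w) (i, true) ^+ 2 / state_weight w (i, true) +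
    state_weight (flip i w) (i, false) ^+ 2 / state_weight w (i, false) =
    d%:R^-1 * (1 + 4 * delta ^+ 2 / ((1 + delta) * (1 - delta))).
  rewrite /state_weight /= flip_at /signr.
  by case: (w i) => /=; field; rewrite ?d_neq0 ?d1 ?d2.
have : 4 * delta ^+ 2 / ((1 + delta) * (1 - delta)) <= 16 / 3 * delta ^+ 2.
  rewrite ler_pdivrMr; last by rewrite mulr_gt0.
  have -> : (1 + delta) * (1 - delta) = 1 - delta ^+ 2 by ring.
  have := sqr_ge0 delta; move: (delta ^+ 2) delta2 => q q4 q0.
  have : 0 <= q * (1 / 4 - q) by rewrite mulr_ge0// subr_ge0 div1r.
  by lra.
have dV : 0 < d%:R^-1 :> R by rewrite invr_gt0.
rewrite -(ler_pM2l dV); move: (4 * delta ^+ 2 / _) => X h.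
by lra.
Qed.

(* The first state is always drawn; afterwards a draw happens with probability
   [p]. *)
Let block_eta k : R := if k == 0%N then chi0 else p * chi0.

Let chi0_ge0 : 0 <= chi0.
Proof.
apply: divr_ge0; last exact: ltW.
by apply: mulr_ge0; [exact: divr_ge0|exact: sqr_ge0].
Qed.

Let sum_first_rest (c : R) n : 0 <= c ->
  \sum_(k < n) (if k == 0%N :> nat then c else p * c) <= c * (1 + p * n%:R).
Proof.
move=> c0; case: n => [|n]; first by rewrite big_ord0 mulr0 addr0 mulr1.
rewrite big_ord_recl (eq_bigr (fun=> p * c)) => [|//].
rewrite sumr_const card_ord -[in leLHS]mulr_natr -natr1 /=.
by have := mulr_ge0 (ltW p_gt0) c0; lra.
Qed.

(* Joint convexity of [x^2 / b]: keeping the old state dilutes the information in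
   a draw. *)
Let mix_chi (x y b : R) : 0 < b -> 0 <= y ->
  (x + y) ^+ 2 / (b + y) <= x ^+ 2 / b + y.
Proof.
move=> b0 y0; have by0 : 0 < b + y by rewrite ltr_wpDr.
rewrite ler_pdivrMr// -subr_ge0.
have -> : (x ^+ 2 / b + y) * (b + y) - (x + y) ^+ 2 = y * (x - b) ^+ 2 / b.
  by field; rewrite gt_eqF.
apply: divr_ge0; last exact: ltW.
by apply: mulr_ge0 => //; exact: sqr_ge0.
Qed.

Let block_chi w i h :
  \sum_v letter_law (block_source (flip i w)) block_visible h v ^+ 2 /
         letter_law (block_source w) block_visible h v <= 1 + block_eta (size h).
Proof.
under eq_bigr do rewrite !block_law.
rewrite /block_eta size_eq0; case: eqP => _; first exact: state_chi.
apply: (@le_trans _ _ (\sum_v (p * (state_weight (flip i w) v ^+ 2 / state_weight w v) +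
   (1 - p) * (v == last v0 h)%:R))).
  apply: ler_sum => v _; apply: le_trans (mix_chi _ _ _) _.
  - by rewrite mulr_gt0// state_weight_gt0.
  - by rewrite mulr_ge0 ?subr_ge0.
  - rewrite lerD2r exprMn le_eqVlt; apply/orP; left; apply/eqP; field.
    by rewrite !gt_eqF ?state_weight_gt0.
rewrite big_split/= -!mulr_sumr.
have -> : \sum_v (v == last v0 h)%:R = 1 :> R.
  by rewrite (bigD1 (last v0 h))//= eqxx big1 ?addr0// => v /negbTE ->.
rewrite mulr1.
apply: (@le_trans _ _ (p * (1 + chi0) + (1 - p))).
  by rewrite lerD2r ler_pM2l// state_chi.
by rewrite mulrDr mulr1 addrAC addrCA subrr addr0.
Qed.

Lemma block_bound :
  exists w, ((d%:R * (theta / 5) ^+ 2 / 2)%:E <= mean_squared_error a (block_instance w))%E.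
Proof.
apply: hard_instance_exists.
  by rewrite card_ffun card_bool card_ord expn_gt0.
move=> s.
pose est (h : seq state) := output a (s, observations block_value s (nth v0 h) N).
have -> : (\sum_w seed_error (block_instance w) s =
    \sum_w \int[source_prob (block_source w)]_u
      (enorm (est (adapted (S := block_source w) block_visible N u) -
              \row_i (- signr (w i) * (theta / 5))) ^+ 2)%:E)%E.
  apply: eq_bigr => w _; apply: eq_integral => u _; congr (_ ^+ 2)%:E; congr enorm.
  rewrite objective_instance (minimizer_hard w mu0 beta0 theta0 theta2).
  congr (output a (s, _) - _).
  apply: observations_adapted => k kN h.
  rewrite block_chainE.
  by rewrite oracle_instance /block_oracle decodeK.
apply: (@seedwise_bound _ _ _ _ block_source (fun=> block_visible) est block_eta).
- by move=> w i h v q0; have := block_law_gt0 w h v; rewrite q0 ltxx.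
- by move=> w i h; exact: block_chi.
- by move=> k; rewrite /block_eta; case: ifP => _; rewrite ?mulr_ge0// ltW.
- apply: le_trans budget.
  exact: sum_first_rest.
Qed.

End block_regime.

(** * Independent states: two-valued observations *)
(** The law of the state may not depend on the query, while the probability of the
    upper value has to vary smoothly with it.  A letter [k] of probability
    [2^-(k+1)] reconciles the two: the [k]-th binary digit of [x] is then a coin of
    bias exactly [x]. *)
Section binary_digits.
Context {R : realType}.
Implicit Types x : R.

Fixpoint binary_rest k x : R :=
  if k is k'.+1 then
    let y := binary_rest k' x in if 2^-1 <= y then 2 * y - 1 else 2 * y
  else x.

Definition bit k x : bool := 2^-1 <= binary_rest k x.

Lemma binary_rest_itv k x : 0 <= x <= 1 -> 0 <= binary_rest k x <= 1.
Proof.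
move=> x01; elim: k => //= k /andP[]; move: (binary_rest k x) => y y0 y1.
by case: (leP 2^-1 y) => y2; apply/andP; split; lra.
Qed.

Lemma binary_expansion n x :
  \sum_(k < n) 2^-1 ^+ k.+1 * (bit k x)%:R + 2^-1 ^+ n * binary_rest n x = x.
Proof.
elim: n => [|n IH]; first by rewrite big_ord0 add0r expr0 mul1r.
rewrite big_ord_recr/= -[RHS]IH -addrA; congr (_ + _).
rewrite /bit exprS; move: (2^-1 ^+ n) (binary_rest n x) => q y.
by case: ifP => _ /=; field.
Qed.

Lemma measurable_bit k : measurable_fun setT (bit k).
Proof.
have mr : measurable_fun setT (binary_rest k).
  elim: k => [|k IH]; first exact: measurable_id.
  apply: measurable_fun_ifT => /=.
  - exact: measurable_fun_ler.
  - by apply: measurable_funB => //; apply: measurable_funM.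
  - by apply: measurable_funM.
exact: measurable_fun_ler.
Qed.

Definition geometric_half (k : nat) : R := 2^-1 ^+ k.+1.

Let geometric_ge0 k : 0 <= geometric_half k.
Proof. by rewrite exprn_ge0. Qed.

Lemma cumul_geometric n : cumul geometric_half n = 1 - 2^-1 ^+ n.
Proof.
elim: n => [|n IH]; first by rewrite /cumul big_ord0 expr0 subrr.
rewrite /cumul big_ord_recr/= -/(cumul _ _) IH /geometric_half exprS.
by field.
Qed.

Let cumul_geometric_le1 n : cumul geometric_half n <= 1.
Proof. by rewrite cumul_geometric gerBl exprn_ge0. Qed.

Lemma half_power_small e : 0 < e -> exists n, 2^-1 ^+ n < e :> R.
Proof.
move=> e0; exists (Num.bound e^-1); rewrite exprVn invf_plt ?posrE ?exprn_gt0//.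
apply: lt_le_trans (_ : (Num.bound e^-1)%:R <= _).
  by have := archi_boundP (ltW (_ : 0 < e^-1)); apply; rewrite invr_gt0.
by rewrite -natrX ler_nat ltnW// ltn_expl.
Qed.

Let cumul_geometric_sup e : 0 < e -> exists n, 1 - e < cumul geometric_half n.
Proof.
move=> /half_power_small[n en]; exists n.
by rewrite cumul_geometric ltrD2l ltrN2.
Qed.

Definition geometric_source : bernoulli_shift geometric_half :=
  lebesgue_source geometric_ge0 cumul_geometric_le1 cumul_geometric_sup.

Local Notation P := (source_prob geometric_source).

Lemma measurable_bit_letter x b :
  measurable [set u : source geometric_source | bit (letter u) x = b].
Proof. exact: (measurable_letter_in geometric_source [set l | bit l x = b]). Qed.

Let partial_le x b n :
  \sum_(k < n) 2^-1 ^+ k.+1 * (bit k x == b)%:R <=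
  value_prob P (fun u => bit (letter u) x) b.
Proof.
rewrite -lee_fin -value_probE; last by move=> c; exact: measurable_bit_letter.
rewrite (measure_partition (@measurable_letter _ _ geometric_source)); last first.
  exact: measurable_bit_letter.
apply: le_trans (nneseries_lim_ge n _); last by move=> k _ _; exact: measure_ge0.
rewrite -sumEFin big_mkord; apply: lee_sum => k _.
have [bk|nbk] := eqVneq (bit k x) b.
  rewrite mulr1 (_ : _ `&` _ = (@letter _ _ geometric_source) @^-1` [set k : nat]).
    by have := prob_letter geometric_source k; rewrite /geometric_half => <-.
  by apply/seteqP; split => [u []//|u /= ->].
by rewrite mulr0 measure_ge0.
Qed.

(** The first [n] letters already give probability at least [x - 2^-n] to a digit
    [1] and at least [1 - x - 2^-n] to a digit [0]. *)
Lemma bit_law x b : 0 <= x <= 1 ->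
  value_prob P (fun u => bit (letter u) x) b = if b then x else 1 - x.
Proof.
move=> x01.
pose v := value_prob P (fun u => bit (letter u) x).
have sum1 : v true + v false = 1.
  have := @sum_value_prob _ _ _ _ P (fun u => bit (letter u) x)
    (fun c => measurable_bit_letter x c).
  by rewrite big_bool.
have low_true : x <= v true.
  apply/ler_addgt0Pl => e /half_power_small[n en].
  have := partial_le x true n; have := binary_expansion n x.
  under eq_bigr do rewrite -[bit _ _]eqb_id.
  rewrite -/v; move: (\sum_(_ < _) _) => s <- sv.
  have /andP[r0 r1] := binary_rest_itv n x01.
  have q0 : 0 <= 2^-1 ^+ n :> R by rewrite exprn_ge0.
  rewrite addrC lerD//; apply: le_trans (ltW en).
  by rewrite ler_piMr.
have low_false : 1 - x <= v false.
  apply/ler_addgt0Pl => e /half_power_small[n en].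
  have := partial_le x false n.
  have -> : \sum_(k < n) 2^-1 ^+ k.+1 * (bit k x == false)%:R =
      cumul geometric_half n - \sum_(k < n) 2^-1 ^+ k.+1 * (bit k x)%:R :> R.
    rewrite /cumul -sumrB; apply: eq_bigr => k _; rewrite /geometric_half.
    by case: (bit k x) => /=; ring.
  rewrite cumul_geometric -/v; have := binary_expansion n x.
  move: (\sum_(_ < _) _) => s xs.
  have /andP[r0 r1] := binary_rest_itv n x01.
  have q0 : 0 <= 2^-1 ^+ n :> R by rewrite exprn_ge0.
  have := mulr_ge0 q0 r0; lra.
rewrite -/v; case: b; lra.
Qed.

End binary_digits.

(** Only the coin flip of each call reaches the algorithm, and its bias moves by at
    most [rho] when one sign is flipped. *)
Section iid_regime.
Context {R : realType} {d tau N : nat} {mu sigma : R}.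
Variable a : one_point_algorithm R d N.
Variables (rho theta : R).
Hypotheses (tau0 : (0 < tau)%N) (mu0 : 0 < mu) (sigma0 : 0 < sigma).
Hypotheses (rho0 : 0 < rho) (rho_half : d%:R * rho <= 2^-1).
Local Notation beta := (sigma * rho).
Hypotheses (theta0 : 0 < theta) (theta2 : mu * theta ^+ 2 = beta).
Hypothesis budget : 16 / 3 * rho ^+ 2 * N%:R <= 2^-1.
Local Notation cube := {ffun 'I_d -> bool}.
Implicit Types (w : cube) (x : 'rV[R]_d).
Local Notation S := (@geometric_source R).

Let beta0 : 0 < beta.
Proof. by rewrite mulr_gt0. Qed.

Definition up_prob w x : R := (1 + rho * signal theta w x) / 2.

Lemma up_prob_itv w x : 4^-1 <= up_prob w x <= 1 - 4^-1.
Proof.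
have : `|rho * signal theta w x| <= 2^-1.
  rewrite normrM (gtr0_norm rho0) mulrC; apply: le_trans rho_half.
  apply: ler_wpM2r; first exact: ltW.
  apply: (le_trans (ler_norm_sum _ _ _)).
  apply: (@le_trans _ _ (\sum_(i < d) 1)); last by rewrite sumr_const card_ord.
  apply: ler_sum => i _; rewrite normrM normr_signr mul1r.
  exact: normr_ripple_le1.
by rewrite /up_prob ler_norml => /andP[l u]; apply/andP; split; lra.
Qed.

Let up_prob01 w x : 0 <= up_prob w x <= 1.
Proof. by have /andP[l u] := up_prob_itv w x; apply/andP; split; lra. Qed.

Definition iid_value x (b : bool) : R :=
  hard_base beta theta x + sigma * (if b then 1 else -1).

Definition iid_oracle w x (z : nat) : R := iid_value x (bit z (up_prob w x)).

Let iid_upd (z l : nat) : nat := l.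

Let iid_lazy : lazy_mapping S id iid_upd 1.
Proof. by move=> z A; rewrite subrr mul0e add0e mul1e. Qed.

Let measurable_iid_oracle w z :
  measurable_fun setT (fun x : borel 'rV[R]_d => iid_oracle w x z).
Proof.
apply: measurable_funD; first exact: measurable_hard_base.
apply: measurable_funM => //; apply: measurable_fun_ifT => //.
apply: (measurableT_comp (measurable_bit z)).
apply: measurable_funM => //; apply: measurable_funD => //.
by apply: measurable_funM => //; exact: measurable_signal.
Qed.

Let iid_oracle_base w x z : `|iid_oracle w x z - hard_base beta theta x| <= sigma.
Proof.
rewrite /iid_oracle /iid_value addrAC subrr add0r normrM (gtr0_norm sigma0).
by case: ifP => _; rewrite ?normrN normr1 mulr1.
Qed.

Let iid_oracle_mean w x :
  (\int[init_law S id]_z (iid_oracle w x z)%:E = (hard_obj beta theta w x)%:E)%E.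
Proof.
have mb b : measurable [set z : borel (discrete_nat R) | bit z (up_prob w x) = b].
  exact: measurable_discrete_nat.
rewrite (integral_finite_valued _ mb (iid_value x)); congr _%:E.
have vE b : value_prob (init_law S id) (fun z => bit z (up_prob w x)) b =
    if b then up_prob w x else 1 - up_prob w x.
  by rewrite -bit_law.
rewrite big_bool/= !vE /iid_value /hard_obj /up_prob.
by move: (hard_base _ _ _) (signal _ _ _) => B s; field.
Qed.

Let ptau1 : (1 - 1) ^+ tau <= 4^-1 :> R.
Proof. by rewrite subrr expr0n gtn_eqF//= invr_ge0. Qed.

Definition iid_instance w : one_point_instance d tau mu sigma :=
  instance_of_lazy_mapping tau0 sigma0 ltr01 (lexx 1) ptau1 iid_lazy
    (measurable_iid_oracle w) (iid_oracle_base w) (iid_oracle_mean w)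
    (hard_differentiable w mu0 beta0 theta0 theta2)
    (ex_intro2 _ _ (8 * mu) (mulr_gt0 (ltr0Sn _ 7) mu0)
       (hard_lipschitz w mu0 beta0 theta0 theta2))
    (hard_strongly_convex w mu0 beta0 theta0 theta2).

Let query_at (s : seed_space a) (h : seq bool) := next_query false iid_value s h.

Definition iid_visible (s : seed_space a) w (h : seq bool) (l : nat) : bool :=
  bit l (up_prob w (query_at s h)).

Let iid_chainE w k u :
  chain (iid_instance w) k u = letter (iter k (@shift_source _ _ S) u).
Proof.
rewrite -[LHS]/(mapping_chain S id iid_upd k u).
by case: k => // k; rewrite mapping_chainS.
Qed.

Let iid_law s w h b : letter_law S (iid_visible s w) h b =
  if b then up_prob w (query_at s h) else 1 - up_prob w (query_at s h).
Proof. by rewrite -bit_law. Qed.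

Let iid_law_gt0 s w h b : 0 < letter_law S (iid_visible s w) h b.
Proof.
rewrite iid_law; have /andP[l u] := up_prob_itv w (query_at s h).
by case: b; lra.
Qed.

Let up_prob_flip w i x : `|up_prob (flip i w) x - up_prob w x| <= rho.
Proof.
have -> : up_prob (flip i w) x - up_prob w x =
    - (rho * (signr (w i) * ripple (x ord0 i / theta))).
  rewrite /up_prob /signal (bigD1 i)//= [in X in _ - X](bigD1 i)//=.
  have -> : \sum_(j < d | j != i) signr (flip i w j) * ripple (x ord0 j / theta) =
      \sum_(j < d | j != i) signr (w j) * ripple (x ord0 j / theta).
    by apply: eq_bigr => j ji; rewrite flip_off.
  rewrite flip_at; move: (\sum_(_ < _ | _) _) (ripple _) => s r.
  by case: (w i); rewrite /signr /=; field.
rewrite normrN normrM [X in _ * X]normrM normr_signr mul1r (gtr0_norm rho0).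
by apply: ler_piMr; [exact: ltW|exact: normr_ripple_le1].
Qed.

Let iid_chi s w i h :
  \sum_b letter_law S (iid_visible s (flip i w)) h b ^+ 2 /
         letter_law S (iid_visible s w) h b <= 1 + 16 / 3 * rho ^+ 2.
Proof.
rewrite big_bool/= !iid_law.
have := up_prob_flip w i (query_at s h); have := up_prob_itv w (query_at s h).
move: (up_prob w (query_at s h)) (up_prob (flip i w) (query_at s h)) => p p' /andP[p1 p2] pp'.
have p0 : 0 < p by lra.
have q0 : 0 < 1 - p by lra.
have -> : p' ^+ 2 / p + (1 - p') ^+ 2 / (1 - p) = 1 + (p' - p) ^+ 2 / (p * (1 - p)).
  by field; rewrite !gt_eqF.
rewrite lerD2l ler_pdivrMr ?mulr_gt0//.
have sq : (p' - p) ^+ 2 <= rho ^+ 2.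
  by rewrite -real_normK ?num_real// ler_sqr ?nnegrE ?(ltW rho0).
apply: (le_trans sq); have := sqr_ge0 rho; move: (rho ^+ 2) => q q_ge0.
have : 3 / 16 <= p * (1 - p) by nra.
by move: (p * (1 - p)) => m m316; nra.
Qed.

Lemma iid_bound :
  exists w, ((d%:R * (theta / 5) ^+ 2 / 2)%:E <= mean_squared_error a (iid_instance w))%E.
Proof.
apply: hard_instance_exists.
  by rewrite card_ffun card_bool card_ord expn_gt0.
move=> s.
pose est (h : seq bool) := output a (s, observations iid_value s (nth false h) N).
have -> : (\sum_w seed_error (iid_instance w) s =
    \sum_w \int[source_prob S]_u
      (enorm (est (adapted (S := S) (iid_visible s w) N u) -
              \row_i (- signr (w i) * (theta / 5))) ^+ 2)%:E)%E.
  apply: eq_bigr => w _; apply: eq_integral => u _; congr (_ ^+ 2)%:E; congr enorm.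
  rewrite objective_instance (minimizer_hard w mu0 beta0 theta0 theta2).
  congr (output a (s, _) - _).
  apply: observations_adapted => k kN h.
  by rewrite iid_chainE.
apply: (@seedwise_bound _ _ _ _ (fun=> S) (iid_visible s) est (fun=> 16 / 3 * rho ^+ 2)).
- by move=> w i h b q0; have := iid_law_gt0 s w h b; rewrite q0 ltxx.
- by move=> w i h; exact: iid_chi.
- by move=> k; rewrite mulr_ge0 ?sqr_ge0// divr_ge0.
- by rewrite sumr_const card_ord -(mulr_natr (16 / 3 * rho ^+ 2) N).
Qed.

End iid_regime.

(** * The lower bound *)
Section lower_bound.
Context {R : realType}.

Lemma bernoulli_inequality (x : R) n : 0 <= x -> 1 + n%:R * x <= (1 + x) ^+ n.
Proof.
move=> x0; elim: n => [|n IH]; first by rewrite mul0r addr0 expr0.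
rewrite exprS -natr1; apply: le_trans (ler_wpM2l _ IH); last by rewrite addr_ge0.
have : 0 <= n%:R * (x * x) by rewrite !mulr_ge0.
by lra.
Qed.

(** The scale of the construction is set by a budget [M] that may exceed the number
    [N] of calls.  With [N] fixed and [M] at its threshold the error cannot
    become small, which is what the complexity statement needs for the values of
    [N] below the threshold. *)
Lemma lower_bound (c : R) (d tau : nat) (mu sigma : R) (M N : nat)
    (a : one_point_algorithm R d N) :
  0 < c -> 16 * c <= 50^-1 ->
  (0 < d)%N -> (0 < tau)%N -> 0 < mu -> 0 < sigma ->
  (d * d + d * tau <= M)%N -> (N <= M)%N ->
  exists I : one_point_instance d tau mu sigma,
    ((c * (Num.sqrt (d%:R * (d%:R + tau%:R) * sigma ^+ 2)
               / (mu * Num.sqrt M%:R)))%:E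
         <= mean_squared_error a I)%E.
Proof.
move=> c0 c_small d0 tau0 mu0 sigma0 budgetM NM.
have d_gt0 : 0 < d%:R :> R by rewrite ltr0n.
have tau_gt0 : 0 < tau%:R :> R by rewrite ltr0n.
have ddM : d%:R * d%:R <= M%:R :> R by rewrite -natrM ler_nat (leq_trans _ budgetM)// leq_addr.
have dtauM : d%:R * tau%:R <= M%:R :> R by rewrite -natrM ler_nat (leq_trans _ budgetM)// leq_addl.
have M0 : 0 < M%:R :> R by apply: lt_le_trans ddM; rewrite mulr_gt0.
have NM' : N%:R <= M%:R :> R by rewrite ler_nat.
set s := Num.sqrt M%:R.
have s0 : 0 < s by rewrite sqrtr_gt0.
have s2 : s ^+ 2 = M%:R by rewrite sqr_sqrtr// ltW.
have sqrt_le (b e : R) : 0 <= e -> b <= e ^+ 2 -> Num.sqrt b <= e.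
  by move=> e0 be; rewrite -[leRHS]ger0_norm// -sqrtr_sqr ler_wsqrtr.
pose scale (beta : R) := Num.sqrt (beta / mu).
have scale_gt0 beta : 0 < beta -> 0 < scale beta.
  by move=> b0; rewrite sqrtr_gt0 divr_gt0.
have scale2 beta : 0 < beta -> mu * scale beta ^+ 2 = beta.
  by move=> b0; rewrite sqr_sqrtr ?divr_ge0 ?ltW// mulrC divfK// gt_eqF.
have finish (beta : R) (I : one_point_instance d tau mu sigma) : 0 < beta ->
    Num.sqrt (d%:R * (d%:R + tau%:R) * sigma ^+ 2) <= 16 * (d%:R * beta) * s ->
    ((d%:R * (scale beta / 5) ^+ 2 / 2)%:E <= mean_squared_error a I)%E ->
    ((c * (Num.sqrt (d%:R * (d%:R + tau%:R) * sigma ^+ 2) / (mu * s)))%:E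
       <= mean_squared_error a I)%E.
  move=> b0 D; apply: le_trans; rewrite lee_fin.
  have -> : d%:R * (scale beta / 5) ^+ 2 / 2 = 50^-1 * (d%:R * beta / mu).
    by rewrite -{2}(scale2 _ b0); field; rewrite gt_eqF.
  rewrite mulrA ler_pdivrMr ?mulr_gt0//.
  apply: (le_trans (ler_wpM2l (ltW c0) D)).
  have -> : c * (16 * (d%:R * beta) * s) = 16 * c * (d%:R * beta * s) by ring.
  have -> : 50^-1 * (d%:R * beta / mu) * (mu * s) = 50^-1 * (d%:R * beta * s).
    by field; rewrite gt_eqF.
  by apply: ler_wpM2r => //; rewrite !mulr_ge0 ?ltW.
have [tau_le_d|d_lt_tau] := leqP tau d.
  (* The information of [N] coin flips is [16 / 3 * rho^2 * N <= 1 / 3]. *)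
  pose rho : R := (4 * s)^-1.
  have rho0 : 0 < rho by rewrite invr_gt0 mulr_gt0.
  have beta0 : 0 < sigma * rho by rewrite mulr_gt0.
  have rho_half : d%:R * rho <= 2^-1.
    have ds : d%:R <= s.
      by rewrite -ler_sqr ?nnegrE ?(ltW d_gt0) ?(ltW s0)// s2 expr2.
    rewrite /rho ler_pdivrMr ?mulr_gt0//; lra.
  have budget : 16 / 3 * rho ^+ 2 * N%:R <= 2^-1.
    rewrite /rho exprVn exprMn s2.
    have -> : 16 / 3 * (4 ^+ 2 * M%:R)^-1 * N%:R = N%:R / M%:R / 3 :> R.
      by field; rewrite gt_eqF.
    have : N%:R / M%:R <= 1 :> R by rewrite ler_pdivrMr// mul1r.
    lra.
  have [w low] := iid_bound a tau0 mu0 sigma0 rho0 rho_half (scale_gt0 _ beta0)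
    (scale2 _ beta0) budget.
  exists (iid_instance tau0 mu0 sigma0 rho0 rho_half (scale_gt0 _ beta0) (scale2 _ beta0) w).
  apply: (finish _ _ beta0 _ low).
  have -> : 16 * (d%:R * (sigma * rho)) * s = 4 * (d%:R * sigma).
    by rewrite /rho; field; rewrite gt_eqF.
  apply: sqrt_le; first by rewrite !mulr_ge0 ?ltW.
  have dtau : tau%:R <= d%:R :> R by rewrite ler_nat.
  rewrite exprMn exprMn mulrA; apply: ler_wpM2r; first exact: sqr_ge0.
  rewrite !expr2; nra.
have dtau : d%:R <= tau%:R :> R by rewrite ler_nat ltnW.
have dt0 : 0 < d%:R * tau%:R :> R by rewrite mulr_gt0.
pose q : R := Num.sqrt (d%:R * tau%:R).
have q0 : 0 < q by rewrite sqrtr_gt0.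
have q2 : q ^+ 2 = d%:R * tau%:R by rewrite sqr_sqrtr// ltW.
(* The first draw contributes at most [1 / 12] and the about [p * N] later ones at
   most [1 / 4] to the information budget. *)
pose delta : R := q / (8 * s).
have delta0 : 0 < delta by rewrite divr_gt0 ?mulr_gt0.
have delta_half : delta <= 2^-1.
  have qs : q <= s by rewrite -ler_sqr ?nnegrE ?(ltW q0) ?(ltW s0)// q2 s2.
  rewrite /delta ler_pdivrMr ?mulr_gt0//; lra.
have tau3 : 0 < 3 + tau%:R :> R by rewrite addr_gt0.
(* [1 - p] is the inverse of [1 + 3 / tau], whose power [tau] is at least [4]. *)
pose p : R := 3 / (3 + tau%:R).
have p0 : 0 < p by rewrite divr_gt0.
have p1 : p <= 1 by rewrite ler_pdivrMr// mul1r lerDl ltW.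
have ptau : (1 - p) ^+ tau <= 4^-1.
  have -> : 1 - p = (1 + 3 / tau%:R)^-1.
    rewrite /p; field; rewrite !gt_eqF//=.
  have base0 : 0 < 1 + 3 / tau%:R :> R by rewrite addr_gt0 ?divr_gt0.
  rewrite exprVn lef_pV2 ?posrE ?exprn_gt0//.
  have := @bernoulli_inequality (3 / tau%:R) tau (divr_ge0 (ler0n _ _) (ler0n _ _)).
  by rewrite mulrCA mulfV ?gt_eqF// mulr1 => /(le_trans _); apply; lra.
have ptau3 : p * tau%:R <= 3.
  by rewrite /p mulrAC ler_pdivrMr// ler_pM2l// lerDr.
have beta0 : 0 < sigma * delta / d%:R := divr_gt0 (mulr_gt0 sigma0 delta0) d_gt0.
have budget : 16 / 3 * delta ^+ 2 / d%:R * (1 + p * N%:R) <= 2^-1.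
  rewrite /delta expr_div_n exprMn q2 s2.
  have -> : 16 / 3 * (d%:R * tau%:R / (8 ^+ 2 * M%:R)) / d%:R * (1 + p * N%:R) =
      (tau%:R + p * tau%:R * N%:R) / M%:R / 12 :> R.
    by field; rewrite !gt_eqF.
  have tauM : tau%:R <= M%:R :> R.
    apply: le_trans dtauM; rewrite -natrM ler_nat leq_pmull//.
  have : (tau%:R + p * tau%:R * N%:R) / M%:R <= 4.
    rewrite ler_pdivrMr//.
    have : p * tau%:R * N%:R <= 3 * M%:R.
      by apply: ler_pM => //; rewrite mulr_ge0 ?ltW.
    lra.
  lra.
have [w low] := block_bound a (Ordinal d0) tau0 mu0 sigma0 delta0 delta_half p0 p1 ptau
  (scale_gt0 _ beta0) (scale2 _ beta0) budget.
exists (block_instance (Ordinal d0) tau0 mu0 sigma0 delta0 delta_half p0 p1 ptau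
  (scale_gt0 _ beta0) (scale2 _ beta0) w).
apply: (finish _ _ beta0 _ low).
have -> : 16 * (d%:R * (sigma * delta / d%:R)) * s = 2 * (q * sigma).
  by rewrite /delta; field; rewrite !gt_eqF.
apply: sqrt_le; first by rewrite !mulr_ge0 ?ltW.
rewrite exprMn exprMn mulrA q2; apply: ler_wpM2r; first exact: sqr_ge0.
rewrite !expr2; nra.
Qed.

End lower_bound.

Theorem theorem6 (R : realType) :
  (exists2 c : R, 0 < c &
    forall (d tau : nat) (mu sigma1 : R),
      (1 <= d)%N -> (1 <= tau)%N -> 0 < mu -> 0 < sigma1 ->
      exists N0 : nat, forall N : nat, (N0 <= N)%N ->
      forall a : one_point_algorithm R d N,
      exists I : one_point_instance d tau mu sigma1,
        ((c * (Num.sqrt (d%:R * (d%:R + tau%:R) * sigma1 ^+ 2)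
               / (mu * Num.sqrt N%:R)))%:E
         <= mean_squared_error a I)%E)
  /\
  (exists2 c : R, 0 < c &
    forall (d tau : nat) (mu sigma1 : R),
      (1 <= d)%N -> (1 <= tau)%N -> 0 < mu -> 0 < sigma1 ->
      exists2 eps0 : R, 0 < eps0 &
      forall eps : R, 0 < eps -> eps < eps0 ->
      forall (N : nat) (a : one_point_algorithm R d N),
        (forall I : one_point_instance d tau mu sigma1,
           (mean_squared_error a I <= eps%:E)%E) ->
        c * (d%:R * (d%:R + tau%:R) * sigma1 ^+ 2 / (mu ^+ 2 * eps ^+ 2))
          <= N%:R).
Proof.
pose c : R := 10^-1 ^+ 3.
have c0 : 0 < c by rewrite exprn_gt0// invr_gt0.
have c_small : 16 * c <= 50^-1 by rewrite /c; lra.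
move: c c0 c_small => c c0 c_small.
split.
  exists c => // d tau mu sigma d0 tau0 mu0 sigma0.
  exists (d * d + d * tau)%N => N NN a.
  exact: lower_bound.
exists (c ^+ 2); first by rewrite exprn_gt0.
move=> d tau mu sigma d0 tau0 mu0 sigma0.
pose M0 := (d * d + d * tau)%N.
have M0_gt0 : (0 < M0)%N by rewrite addn_gt0 muln_gt0 d0.
set D : R := d%:R * (d%:R + tau%:R) * sigma ^+ 2.
have D0 : 0 < D by rewrite !mulr_gt0 ?exprn_gt0 ?addr_gt0 ?ltr0n.
have sD0 : 0 < Num.sqrt D by rewrite sqrtr_gt0.
exists (c * (Num.sqrt D / (mu * Num.sqrt M0%:R))).
  by rewrite mulr_gt0// divr_gt0// mulr_gt0// sqrtr_gt0 ltr0n.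
move=> eps eps0 eps_lt N a small.
have bound M : (M0 <= M)%N -> (N <= M)%N ->
    c * (Num.sqrt D / (mu * Num.sqrt M%:R)) <= eps.
  move=> MM NM; have [I low] := lower_bound a c0 c_small d0 tau0 mu0 sigma0 MM NM.
  by rewrite -lee_fin; exact: le_trans low (small I).
have [NM0|M0N] := leqP N M0.
  by have := lt_le_trans eps_lt (bound M0 (leqnn _) NM0); rewrite ltxx.
have N0 : 0 < N%:R :> R by rewrite ltr0n (leq_ltn_trans _ M0N).
have sN0 : 0 < Num.sqrt N%:R :> R by rewrite sqrtr_gt0.
have h : c * Num.sqrt D <= eps * mu * Num.sqrt N%:R.
  have := bound N (ltnW M0N) (leqnn N).
  by rewrite mulrA ler_pdivrMr ?mulr_gt0// mulrA.
rewrite [leLHS]mulrA ler_pdivrMr ?mulr_gt0 ?exprn_gt0//.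
have -> : N%:R * (mu ^+ 2 * eps ^+ 2) = (eps * mu * Num.sqrt N%:R) ^+ 2.
  by rewrite !exprMn sqr_sqrtr ?(ltW N0)//; ring.
have -> : c ^+ 2 * D = (c * Num.sqrt D) ^+ 2 by rewrite exprMn sqr_sqrtr ?(ltW D0).
by rewrite ler_sqr ?nnegrE ?mulr_ge0 ?sqrtr_ge0 ?(ltW mu0) ?(ltW eps0) ?(ltW c0).
Qed.
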